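(* Under the setting of Proposition (eigenloc) (fixed $K,\ell,\beta,C$, $0\le s\le K-1$, conditioning on $H^{(s)}_{N+K}\in\mathcal H^{(\ell,C)}_{N+s}$), fix $1\le i\le\ell$ and define, for $z\in(\lambda^{(s)}_{i-1},\lambda^{(s)}_i)$ (with $\lambda^{(s)}_0:=-\infty$), $$\mathcal E(z)=h_{N+s+1,N+s+1}-(z+2\sqrt N)-\Big(\sum_{\substack{1\le j\le N+s\\ j\ne i-1,i}}\frac{|\langle{\bf u}^{(s)}_j,{\bf h}^{(s+1)}\rangle|^2}{\lambda_j^{(s)}-z}-\sqrt N\Big).$$ Then for every $A>0$ there is $C'>0$ (depending on $A,C,\ell,K$ and the fourth moment bound) such that for all sufficiently large $N$, every such conditioning, and every $z\in(\lambda^{(s)}_{i-1},\lambda^{(s)}_i)$ with $|z+2\sqrt N|\le(\log N)^CN^{-1/6}$, $$\mathbb P\big(|\mathcal E(z)|\ge(\log N)^{C'}N^{1/6}\big)\le(\log N)^{-A},$$ the probability being over ${\bf h}^{(s+1)}$ and $h_{N+s+1,N+s+1}$.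
   Context: A Wigner matrix $H_N=[h_{ij}]_{1\le i,j\le N}$ is a real symmetric ($\beta=1$) or complex Hermitian ($\beta=2$) $N\times N$ random matrix whose entries $h_{ij}=\overline{h_{ji}}$, $i\le j$, are independent, with $\mathbb E h_{ij}=0$, $\mathbb E|h_{ij}|^2=1$, and $\sup_{i,j,N}\mathbb E|h_{ij}|^4<\infty$; in the Hermitian case, for $i<j$, $\Re h_{ij}$ and $\Im h_{ij}$ are independent with $\mathbb E[(\Re h_{ij})^2]=\mathbb E[(\Im h_{ij})^2]=1/2$. $H^{(s)}_{N+K}=[h_{ij}]_{1\le i,j\le N+s}$ has eigenvalues $\lambda^{(s)}_1\le\dots\le\lambda^{(s)}_{N+s}$ with orthonormal eigenvectors ${\bf u}^{(s)}_j$; ${\bf h}^{(s+1)}=(h_{1,N+s+1},\dots,h_{N+s,N+s+1})^\top$. $\rho_{sc}(x)=\frac{\sqrt{4-x^2}}{2\pi}\mathbf 1_{[-2,2]}(x)$. $\mathcal H^{(\ell,C)}_n$ is the set of $n\times n$ real symmetric/complex Hermitian matrices with eigenvalues $\lambda_1\le\dots\le\lambda_n$ and orthonormal eigenvectors ${\bf u}_1,\dots,{\bf u}_n$ such that: (1) $\big||\{j:\lambda_j\le E\sqrt n\}|-n\int_{-\infty}^E\rho_{sc}(x)dx\big|\le(\log n)^C$ for all $E\in\mathbb R$; (2) $\|{\bf u}_i\|_\infty\le(\log n)^C/\sqrt n$ for all $i$; (3) $|\lambda_i+2\sqrt n|\le(\log n)^Cn^{-1/6}$ and $\lambda_{i+1}-\lambda_i\ge(\log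 n)^{-C}n^{-1/6}$ for $1\le i\le\ell$. *)

(* Defs.v *)
From HB Require Import structures.
From mathcomp Require Import all_boot all_order all_algebra.
From mathcomp Require Import all_classical all_reals all_analysis.
From mathcomp Require Import complex.

Set Implicit Arguments.
Unset Strict Implicit.
Unset Printing Implicit Defensive.

Import Order.TTheory GRing.Theory Num.Theory.
Local Open Scope classical_set_scope.
Local Open Scope ring_scope.

Section WignerDefs.
Variable R : realType.

(** semicircle density *)
Definition rho_sc (x : R) : R :=
  if (-2 <= x <= 2)%R then Num.sqrt (4 - x ^+ 2) / (2 * pi) else 0.

(** int_{-oo}^E rho_sc(x) dx (Lebesgue integral) *)
Definition sc_cdf (E : R) : R :=
  Rintegral lebesgue_measure `]-oo, E] rho_sc.

(** (log n)^a with a real exponent *)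
Definition logpow (n : nat) (a : R) : R := (ln (n%:R : R)) `^ a.
(** n^a with a real exponent *)
Definition natpow (n : nat) (a : R) : R := (n%:R : R) `^ a.

(** modulus and squared modulus of a complex number *)
Definition cabs2 (x : R[i]) : R := complex.Re x ^+ 2 + complex.Im x ^+ 2.
Definition cabs (x : R[i]) : R := Num.sqrt (cabs2 x).

(** conjugate transpose *)
Definition adjmx n m (A : 'M[R[i]]_(n, m)) : 'M[R[i]]_(m, n) :=
  (map_mx (fun x : R[i] => x^*) A)^T.

(** Spectral data of an n x n matrix M of symmetry class beta (1: real
    symmetric, 2: complex Hermitian): lam 1 <= ... <= lam n are its
    eigenvalues (1-based indexing: lam j for 1 <= j <= n) and the column
    j : 'I_n of U is an eigenvector u_{j+1} for lam (j+1); the columns of U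
    are orthonormal.  In the real case everything is real. *)
Definition spectral_data (beta n : nat) (M U : 'M[R[i]]_n) (lam : nat -> R) : Prop :=
  [/\ M = adjmx M,
      beta = 1%N -> forall a b, complex.Im (M a b) = 0 /\ complex.Im (U a b) = 0,
      adjmx U *m U = 1%:M,
      M *m U = U *m diag_mx (\row_(j < n) ((lam j.+1)%:C)%C)
    & forall j k : nat, (1 <= j <= k)%N -> (k <= n)%N -> lam j <= lam k].

(** The class H^{(l,C)}_n, conditions (1)-(3). *)
Definition in_class (l : nat) (C : R) (n : nat) (U : 'M[R[i]]_n) (lam : nat -> R)
  : Prop :=
  [/\ (forall E : R,
         `| (#|[set j : 'I_n | lam j.+1 <= E * Num.sqrt (n%:R)]|%:R : R)
            - n%:R * sc_cdf E | <= logpow n C),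
      (forall a j : 'I_n, cabs (U a j) <= logpow n C / Num.sqrt (n%:R))
    & (forall i : nat, (1 <= i <= l)%N ->
         `| lam i + 2 * Num.sqrt (n%:R) | <= logpow n C * natpow n (- (1/6))
         /\ logpow n (- C) * natpow n (- (1/6)) <= lam i.+1 - lam i)].

Section Proba.
Context d (T : measurableType d) (P : probability T R).

(** mutual independence of a finite family of real random variables *)
Definition mutually_independent (I : finType) (f : I -> T -> R) : Prop :=
  forall (J : {set I}) (B : I -> set R),
    (forall i, measurable (B i)) ->
    fine (P (\bigcap_(i in [set i | i \in J]) (f i @^-1` B i)))
    = \prod_(i in J) fine (P (f i @^-1` B i)).

(** expectation of a real function, as an extended real *)
Definition Ex (f : T -> R) : \bar R := (\int[P]_w (f w)%:E)%E.

(** new column of a Wigner matrix of class beta and fourth-moment bound M4: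
    h_k = X k + i Y k (k : 'I_n) and the diagonal entry D. *)
Definition wigner_column (beta n : nat) (M4 : R)
    (X Y : 'I_n -> T -> R) (D : T -> R) : Prop :=
  [/\ (forall k, measurable_fun setT (X k)) /\ (forall k, measurable_fun setT (Y k))
        /\ measurable_fun setT D,
      mutually_independent
        (fun o : option ('I_n * bool) =>
           match o with None => D | Some (k, false) => X k | Some (k, true) => Y k end),
      [/\ Ex D = 0%E, Ex (fun w => D w ^+ 2) = 1%E
        & (Ex (fun w => (D w ^+ 4)%R) <= M4%:E)%E],
      (forall k, [/\ Ex (X k) = 0%E, Ex (Y k) = 0%E &
          (Ex (fun w => ((X k w ^+ 2 + Y k w ^+ 2) ^+ 2)%R) <= M4%:E)%E])
    & (if beta == 1%N then forall k, Ex (fun w => X k w ^+ 2) = 1%E /\ (forall w, Y k w = 0)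
       else forall k, Ex (fun w => X k w ^+ 2) = (1/2)%:E /\
                      Ex (fun w => Y k w ^+ 2) = (1/2)%:E)].

End Proba.

Local Open Scope complex_scope.

(** the quantity E(z) (at sample point w), for 1 <= i:
    h_{N+s+1,N+s+1} - (z + 2 sqrt N)
      - (sum_{j <> i-1, i} |<u_j, h>|^2 / (lam_j - z) - sqrt N) *)
Definition calE (N n i : nat) (U : 'M[R[i]]_n) (lam : nat -> R)
    (hX hY : 'I_n -> R) (hd : R) (z : R) : R :=
  hd - (z + 2 * Num.sqrt (N%:R))
  - (\sum_(j < n | (j.+1 != i.-1) && (j.+1 != i))
        cabs2 (\sum_(k < n) (U k j)^* * (hX k +i* hY k)) / (lam j.+1 - z)
     - Num.sqrt (N%:R)).

End WignerDefs.

(* Main.v *)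
(** Subtracting the conditional mean, [calE] is [D - W - m], where [W] is the
    centred quadratic form of the new column and [m] is deterministic, so by
    Chebyshev's inequality it suffices that [m] is of order [N^(1/6)] and that
    [W] has variance of order [N^(1/3)], both up to powers of [log N].

    The variance of the quadratic form of independent centred variables is at
    most a constant times the squared Frobenius norm of its matrix, here
    [sum_j (lam_j - z)^-2].

    For the deterministic sums, write [x_j = lam_j / sqrt n], [phi(x) = 1/(x+2)],
    [F] for the semicircle distribution function and [H] for the antiderivative
    of [rho_sc * phi] with [H(-2) = 0], so that [H(2) = 1].  Since
    [phi(b) (F b - F a) <= H b - H a <= phi(a) (F b - F a)], the quantity
    [Psi_j = H(x_j) + phi(x_j) (j/n - F(x_j))] increases by [phi(x_j)/n] up to a
    telescoping error governed by the counting estimate [|j/n - F(x_j)|].  This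
    replaces the sum of the [phi(x_j)] beyond a polylogarithmic index by
    [1 - H(x_p)]; the remaining indices are handled by the gap condition. *)

Require Import Defs.
From HB Require Import structures.
From mathcomp Require Import all_boot all_order all_algebra.
From mathcomp Require Import all_classical all_reals all_analysis.
From mathcomp Require Import complex.
From mathcomp Require Import measurable_realfun ring lra.
Import Order.TTheory GRing.Theory Num.Theory.
Import numFieldNormedType.Exports.
Local Open Scope classical_set_scope.
Local Open Scope ring_scope.

Set Implicit Arguments.
Unset Strict Implicit.

(** * Independence *)

(** By uniqueness of the product measure, independence makes the joint law of [f] and [g] the
    product of their laws. Fubini then integrates over the first coordinate first, where [k] is a
    constant factor and [h] has integral 0. *)
Lemma indep_integral_eq0 (R : realType) (d d1 d2 : measure_display) (T : measurableType d)
    (S1 : measurableType d1) (S2 : measurableType d2) (P : probability T R)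
    (f : {mfun T >-> S1}) (g : {mfun T >-> S2}) (h : S1 -> R) (k : S2 -> R) :
  (forall A B, measurable A -> measurable B ->
     P (f @^-1` A `&` g @^-1` B) = (P (f @^-1` A) * P (g @^-1` B))%E) ->
  measurable_fun setT h -> measurable_fun setT k ->
  P.-integrable setT (EFin \o (h \o f)) ->
  P.-integrable setT (fun w => (h (f w) * k (g w))%:E) ->
  (\int[P]_w (h (f w))%:E = 0)%E ->
  (\int[P]_w (h (f w) * k (g w))%:E = 0)%E.
Proof.
move=> ind mh mk ih ihk h0.
pose fg := fun w => (f w, g w).
have mfg : measurable_fun setT fg by exact: measurable_fun_pair.
pose F := EFin \o (fun x : S1 * S2 => h x.1 * k x.2).
have mF : measurable_fun [set: S1 * S2] F.
  apply/measurable_EFinP; apply: measurable_funM; exact: measurableT_comp.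
pose mu1 : probability S1 R := distribution P f.
pose mu2 : probability S2 R := distribution P g.
pose pfg : {mfun T >-> (S1 * S2)%type} := mfun_Sub (mem_set mfg).
pose m' : probability (S1 * S2)%type R := distribution P pfg.
have eqm (X : set (S1 * S2)) : measurable X -> (mu1 \x mu2)%E X = m' X.
  by move=> mX; apply: product_measure_unique.
have iF' : m'.-integrable setT F.
  by apply: integrable_pushforward.
have iF : (mu1 \x mu2)%E.-integrable setT F.
  have [_ lF] := integrableP _ _ _ iF'.
  apply/integrableP; split => //.
  rewrite (eq_measure_integral m')// => A mA _.
  exact: eqm.
have -> : (\int[P]_w (h (f w) * k (g w))%:E = \int[mu1 \x mu2]_x F x)%E.
  rewrite (eq_measure_integral m')//; last by move=> A mA _; exact: eqm.
  by rewrite integral_distribution.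
rewrite -integral21_prod_meas1 //.
have hmu : (\int[mu1]_x (h x)%:E = 0)%E.
  by rewrite -h0 (integral_distribution (f := EFin \o h))//; exact/measurable_EFinP.
have imu : mu1.-integrable setT (EFin \o h).
  by apply: integrable_pushforward => //; exact/measurable_EFinP.
apply: integral0_eq => y _; rewrite /fubini_G /F /=.
under eq_integral do rewrite mulrC EFinM.
by rewrite integralZl // hmu mule0.
Qed.
(* A pi-system generating the sigma-algebra of all the variables but [xi a]. *)
Definition others_system (R : realType) (d : measure_display) (T : measurableType d)
    (I : finType) (xi : I -> T -> R) (a : I) : set (set T) :=
  [set E | exists2 B : I -> set R, (forall i, measurable (B i)) &
             E = \bigcap_(i in [set i | i != a]) xi i @^-1` B i].

Section Independence.
Context {R : realType} {d : measure_display} {T : measurableType d}.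
Context (P : probability T R) {I : finType} {xi : I -> T -> R}.
Hypothesis mxi : forall i, measurable_fun setT (xi i).

Let mpre i B : measurable B -> measurable (xi i @^-1` B).
Proof. by move=> mB; rewrite -[X in measurable X]setTI; exact: mxi. Qed.

Lemma others_system_measurable (a : I) : others_system xi a `<=` measurable.
Proof.
move=> _ [B mB ->]; apply: fin_bigcap_measurable; first exact: finite_finset.
by move=> i _; exact: mpre.
Qed.

Lemma others_system_setI (a : I) : setI_closed (others_system xi a).
Proof.
move=> _ _ [B mB ->] [B' mB' ->]; exists (fun i => B i `&` B' i).
  by move=> i; exact: measurableI.
apply/seteqP; split=> w /=.
  by move=> [h1 h2] i ia; split; [exact: h1|exact: h2].
by move=> h; split=> i ia; have [] := h i ia.
Qed.

Lemma measurable_fun_others (a b : I) : b != a ->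
  measurable_fun [set: g_sigma_algebraType (others_system xi a)] (xi b).
Proof.
move=> ba _ B mB; rewrite setTI; apply: sub_sigma_algebra.
exists (fun i => if i == b then B else setT).
  by move=> i; case: ifP.
apply/seteqP; split=> w /=.
  by move=> h i ia; case: eqP => [->|].
by move=> /(_ b ba); rewrite eqxx.
Qed.

Hypothesis ind : mutually_independent P xi.

(** As functions of [E] both sides are finite measures, a restriction and a scalar multiple of [P].
    They agree on the pi-system [others_system xi a], hence on the sigma-algebra it generates. *)
Lemma indep_others (a : I) (A : set R) (E : set T) :
  measurable A -> <<s others_system xi a >> E ->
  P (xi a @^-1` A `&` E) = (P (xi a @^-1` A) * P E)%E.
Proof.
move=> mA sE.
have fP (X : set T) : measurable X -> P X \is a fin_num by exact: fin_num_measure.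
have base (F : set T) : others_system xi a F ->
    P (xi a @^-1` A `&` F) = (P (xi a @^-1` A) * P F)%E.
  move=> oF; have mF := @others_system_measurable a _ oF.
  case: oF => B mB FE.
  have mAF : measurable (xi a @^-1` A `&` F) by apply: measurableI => //; exact: mpre.
  rewrite -[LHS]fineK ?fP // -[X in (X * _)%E]fineK ?fP//; last exact: mpre.
  rewrite -[X in (_ * X)%E]fineK ?fP // -EFinM; congr (_%:E).
  have := @ind [set i | i != a]%SET B mB.
  have -> : \bigcap_(i in [set i | i \in [set i | i != a]%SET]) xi i @^-1` B i = F.
    by rewrite FE; apply/seteqP; split=> w /= h i; move: (h i); rewrite /= inE.
  move=> ->.
  (* Mutual independence is used twice: above over the indices other than [a], which computes [P F],
     and now over all indices with [A] inserted at [a]. *)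
  pose B' i := if i == a then A else B i.
  have mB' i : measurable (B' i) by rewrite /B'; case: ifP.
  have := @ind [set: I]%SET B' mB'.
  have -> : \bigcap_(i in [set i | i \in [set: I]%SET]) xi i @^-1` B' i =
            xi a @^-1` A `&` F.
    rewrite FE; apply/seteqP; split=> w /=.
      move=> h; split; first by have := h a (finset.in_setT a); rewrite /B' eqxx.
      by move=> i ia; have := h i (finset.in_setT i); rewrite /B' (negbTE ia).
    by move=> [h1 h2] i _; rewrite /B'; case: eqP => [->//|/eqP ia]; exact: h2.
  move=> ->; rewrite (bigD1 a) ?finset.in_setT//= /B' eqxx; congr (_ * _).
  apply: eq_big => [i|i]; first by rewrite !inE.
  by move=> /andP[_ /negbTE ->].
have mXA : measurable (xi a @^-1` A) by exact: mpre.
have P0 : 0 <= fine (P (xi a @^-1` A)) by rewrite fine_ge0.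
have mscaleE X : mscale (NngNum P0) P X = (P (xi a @^-1` A) * P X)%E.
  by rewrite /mscale /= -[in RHS](@fineK _ (P (xi a @^-1` A))) ?fP.
rewrite setIC -mscaleE -[LHS]/(mrestr P mXA E).
apply: (@g_sigma_algebra_measure_unique d R T (others_system xi a)
  (@others_system_measurable a) (fun=> setT)) => //.
- move=> _; exists (fun=> setT) => //.
  by apply/seteqP; split=> w.
- by rewrite bigcup_const//; exists 0%N.
- exact: others_system_setI.
- move=> F oF; apply: etrans (esym (mscaleE F)).
  by rewrite -base// setIC.
- move=> _; change (P (setT `&` xi a @^-1` A) < +oo)%E.
  by rewrite setTI -ge0_fin_numE ?fP.
Qed.

(** The second variable fed to [indep_integral_eq0] is the identity of [T], seen as a map into [T]
    with the coarser sigma-algebra generated by the other variables. *)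
Lemma integral_indep_eq0 (a : I) (h : R -> R) (k : T -> R) :
  measurable_fun setT h ->
  measurable_fun [set: g_sigma_algebraType (others_system xi a)] k ->
  P.-integrable setT (EFin \o (h \o xi a)) ->
  P.-integrable setT (fun w => (h (xi a w) * k w)%:E) ->
  (\int[P]_w (h (xi a w))%:E = 0)%E ->
  (\int[P]_w (h (xi a w) * k w)%:E = 0)%E.
Proof.
move=> mh mk.
have mid : measurable_fun setT
    (idfun : T -> g_sigma_algebraType (others_system xi a)).
  move=> _ B mB; rewrite setTI preimage_id.
  apply: smallest_sub mB; first exact: sigma_algebra_measurable.
  exact: others_system_measurable.
apply: (@indep_integral_eq0 _ _ _ _ _ _ _ P (mfun_Sub (mem_set (mxi a)))
  (mfun_Sub (mem_set mid))) => //.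
by move=> A B mA mB; exact: indep_others.
Qed.
End Independence.

(** * Variance of quadratic forms *)

Lemma Rintegral_sum (R : realType) (d : measure_display) (T : measurableType d)
    (mu : {measure set T -> \bar R}) (J : Type) (r : seq J) (F : J -> T -> R) :
  (forall j, mu.-integrable setT (EFin \o F j)) ->
  \int[mu]_w (\sum_(j <- r) F j w) = \sum_(j <- r) \int[mu]_w F j w.
Proof.
move=> iF.
have iS s : mu.-integrable setT (EFin \o (fun w => \sum_(j <- s) F j w)).
  have -> : EFin \o (fun w => \sum_(j <- s) F j w) =
            (fun w => \sum_(j <- s) (EFin \o F j) w)%E.
    by apply/funext => w /=; rewrite sumEFin.
  exact: integrable_sum.
elim: r => [|j r IH].
  rewrite big_nil (_ : (fun _ => _) = fun=> 0); last by apply/funext=> w; rewrite big_nil.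
  by rewrite /Rintegral integral0.
rewrite big_cons -IH -RintegralD//.
by apply: eq_Rintegral => w _; rewrite big_cons.
Qed.

Lemma normrM_le_sqr (R : realType) (x y : R) : `|x * y| <= x ^+ 2 + y ^+ 2.
Proof.
by have := sqr_ge0 (x - y); have := sqr_ge0 (x + y); rewrite ler_norml; nra.
Qed.

Lemma sqrrM_le_expr4 (R : realType) (x y : R) : x ^+ 2 * y ^+ 2 <= 2^-1 * (x ^+ 4 + y ^+ 4).
Proof. by have := sqr_ge0 (x ^+ 2 - y ^+ 2); lra. Qed.

Lemma normr_le_expr4 (R : realType) (x : R) : `|x| <= 1 + x ^+ 4.
Proof.
have := sqr_ge0 (x ^+ 2 - 1); have := sqr_ge0 (x - 1); have := sqr_ge0 (x + 1).
by have := sqr_ge0 (x ^+ 2); rewrite ler_norml; lra.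
Qed.

Lemma normrM_le_expr4 (R : realType) (x y : R) : `|x * y| <= 1 + (x ^+ 4 + y ^+ 4).
Proof.
have := sqr_ge0 (x ^+ 2 - 1); have := sqr_ge0 (y ^+ 2 - 1).
have := sqr_ge0 (x ^+ 2); have := sqr_ge0 (y ^+ 2).
by have := sqr_ge0 (x - y); have := sqr_ge0 (x + y); rewrite ler_norml; lra.
Qed.

(** When [c] is the mean of [x * y], the terms in [c] integrate to [- c ^ 2]. The factor 1/2 thus
    bounds the variance of [x * y] by the fourth-moment bound [M] itself; the cruder
    [sqr_subM_le_expr4] serves integrability. *)
Lemma sqr_subM_le_half (R : realType) (x y c : R) :
  (x * y - c) * (x * y - c) <=
  2^-1 * (x ^+ 4 + y ^+ 4) + ((- (2 * c)) * (x * y) + c ^+ 2).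
Proof. by have := sqrrM_le_expr4 x y; lra. Qed.

Lemma sqr_subM_le_expr4 (R : realType) (x y c : R) :
  (x * y - c) ^+ 2 <= x ^+ 4 + y ^+ 4 + 2 * c ^+ 2.
Proof.
by have := sqrrM_le_expr4 x y; have := sqr_ge0 (x * y + c); lra.
Qed.

Section Variance.
Context {R : realType} {d : measure_display} {T : measurableType d}.
Context (P : probability T R) {I : finType} {xi : I -> T -> R} {M : R}.
Hypothesis mxi : forall i, measurable_fun setT (xi i).
Hypothesis ind : mutually_independent P xi.
Hypothesis xi1 : forall i, (\int[P]_w (xi i w)%:E = 0)%E.
Hypothesis xi4 : forall i, (\int[P]_w (xi i w ^+ 4)%:E <= M%:E)%E.

Let int := fun f : T -> R => P.-integrable setT (EFin \o f).

Let int_xi4 i : int (fun w => xi i w ^+ 4).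
Proof.
apply/integrableP; split.
  by apply/measurable_EFinP; exact: measurable_funX.
apply: le_lt_trans (ltry M); apply: le_trans (xi4 i).
rewrite le_eqVlt; apply/orP; left; apply/eqP; apply: eq_integral => w _.
by rewrite /= ger0_norm ?exprn_even_ge0.
Qed.

Let int_cst (c : R) : int (fun=> c).
Proof. exact: finite_measure_integrable_cst. Qed.

Let int_le (f g : T -> R) :
  measurable_fun setT f -> (forall w, `|f w| <= g w) -> int g -> int f.
Proof.
move=> mf fg ig; apply: le_integrable ig => //; first exact/measurable_EFinP.
move=> w _ /=; rewrite lee_fin (le_trans (fg w))//; exact: ler_norm.
Qed.

Let intD (f g : T -> R) : int f -> int g -> int (fun w => f w + g w).
Proof.
move=> If Ig; have := integrableD measurableT If Ig.
by apply: eq_integrable => // w _.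
Qed.

Let intZ (c : R) (f : T -> R) : int f -> int (fun w => c * f w).
Proof.
move=> If; have := integrableZl measurableT c If.
by apply: eq_integrable => // w _.
Qed.

Let int_xi i : int (xi i).
Proof.
apply: (@int_le _ (fun w => 1 + xi i w ^+ 4)) => //; last exact: intD.
by move=> w; exact: normr_le_expr4.
Qed.

Definition cov2 (p : I * I) : R := \int[P]_w (xi p.1 w * xi p.2 w).
Definition cprod (p : I * I) (w : T) : R := xi p.1 w * xi p.2 w - cov2 p.

Let mxi2 p : measurable_fun setT (fun w => xi p.1 w * xi p.2 w).
Proof. exact: measurable_funM. Qed.

Let int_xi2 p : int (fun w => xi p.1 w * xi p.2 w).
Proof.
apply: (@int_le _ (fun w => 1 + (xi p.1 w ^+ 4 + xi p.2 w ^+ 4))) => //.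
  by move=> w; exact: normrM_le_expr4.
by do 2 apply: intD => //.
Qed.

Lemma measurable_cprod p : measurable_fun setT (cprod p).
Proof. exact: measurable_funB. Qed.

Lemma integrable_cprodM p q : P.-integrable setT (EFin \o (fun w => cprod p w * cprod q w)).
Proof.
have sq p0 : int (fun w => cprod p0 w ^+ 2).
  apply: (@int_le _ (fun w => (xi p0.1 w ^+ 4 + xi p0.2 w ^+ 4) + 2 * cov2 p0 ^+ 2)).
  - apply: measurable_funX; exact: measurable_cprod.
  - move=> w; rewrite ger0_norm ?sqr_ge0// /cprod.
    exact: sqr_subM_le_expr4.
  - by do 2 apply: intD => //.
apply: (@int_le _ (fun w => cprod p w ^+ 2 + cprod q w ^+ 2)); last exact: intD.
  by apply: measurable_funM; exact: measurable_cprod.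
by move=> w; exact: normrM_le_sqr.
Qed.

Lemma Rintegral_probability_cst (c : R) : \int[P]_w c = c.
Proof.
rewrite Rintegral_cst// -[RHS]mulr1; congr (_ * _).
by change (fine (P [set: T]) = 1); rewrite probability_setT.
Qed.

Lemma cprod_sq_le p : \int[P]_w (cprod p w * cprod p w) <= M.
Proof.
have E0 : \int[P]_w (cprod p w * cprod p w) <=
    \int[P]_w (2^-1 * (xi p.1 w ^+ 4 + xi p.2 w ^+ 4) +
               ((- (2 * cov2 p)) * (xi p.1 w * xi p.2 w) + cov2 p ^+ 2)).
  apply: le_Rintegral => //; first exact: integrable_cprodM.
    by apply: intD; [apply: intZ; exact: intD|apply: intD => //; exact: intZ].
  move=> w _; rewrite /cprod.
  exact: sqr_subM_le_half.
apply: le_trans E0 _.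
have i0 : int (fun w => xi p.1 w ^+ 4 + xi p.2 w ^+ 4) by exact: intD.
have i1 : int (fun w => 2^-1 * (xi p.1 w ^+ 4 + xi p.2 w ^+ 4)) by exact: intZ.
have i2 : int (fun w => - (2 * cov2 p) * (xi p.1 w * xi p.2 w)) by exact: intZ.
have i3 : int (fun w => - (2 * cov2 p) * (xi p.1 w * xi p.2 w) + cov2 p ^+ 2).
  exact: intD.
rewrite (RintegralD measurableT i1 i3) (RintegralD measurableT i2 (int_cst _)).
rewrite (RintegralZl _ measurableT i0) (RintegralZl _ measurableT (int_xi2 p)).
rewrite (RintegralD measurableT (int_xi4 _) (int_xi4 _)) Rintegral_probability_cst.
rewrite -/(cov2 p).
have b i : \int[P]_w (xi i w ^+ 4) <= M.
  have fi : (\int[P]_w (xi i w ^+ 4)%:E \is a fin_num)%E.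
    exact: integrable_fin_num (int_xi4 i).
  by rewrite -lee_fin /Rintegral fineK.
have := b p.1; have := b p.2; nra.
Qed.

Lemma Rintegral_of_integral0 (f : T -> R) : (\int[P]_w (f w)%:E = 0)%E -> \int[P]_w f w = 0.
Proof. by rewrite /Rintegral => ->. Qed.

Let mo a b : b != a -> 
  measurable_fun [set: g_sigma_algebraType (others_system xi a)] (xi b).
Proof. exact: measurable_fun_others. Qed.

Lemma cov2_neq p : p.1 != p.2 -> cov2 p = 0.
Proof.
move=> p12; apply: Rintegral_of_integral0.
apply: (@integral_indep_eq0 _ _ _ _ _ _ mxi ind p.1 idfun (xi p.2)).
- exact: measurable_id.
- by apply: mo; rewrite eq_sym.
- exact: int_xi.
- exact: int_xi2.
- exact: xi1.
Qed.

(** The index [a] occurs exactly once in the product and [cov2 (a, b)] vanishes, so the centred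
    factor [xi a] splits off by independence. *)
Lemma cprod_orth_off a b q : a != b -> a != q.1 -> a != q.2 ->
  \int[P]_w (cprod (a, b) w * cprod q w) = 0.
Proof.
move=> ab aq1 aq2; apply: Rintegral_of_integral0.
have E w : cprod (a, b) w * cprod q w = xi a w * (xi b w * cprod q w).
  by rewrite {1}/cprod cov2_neq //= subr0 mulrA.
under eq_integral do rewrite E.
apply: (@integral_indep_eq0 _ _ _ _ _ _ mxi ind a idfun (fun w => xi b w * cprod q w)).
- exact: measurable_id.
- apply: measurable_funM; first by apply: mo; rewrite eq_sym.
  apply: measurable_funB => //; apply: measurable_funM; apply: mo; by rewrite eq_sym.
- exact: int_xi.
- have := integrable_cprodM (a, b) q; apply: eq_integrable => // w _ /=.
  by rewrite E.
- exact: xi1.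
Qed.

Lemma cprod_orth_diag a b : a != b ->
  \int[P]_w (cprod (a, a) w * cprod (b, b) w) = 0.
Proof.
move=> ab; apply: Rintegral_of_integral0.
apply: (@integral_indep_eq0 _ _ _ _ _ _ mxi ind a (fun x => x * x - cov2 (a, a))
  (cprod (b, b))).
- apply: measurable_funB => //; exact: measurable_funM.
- apply: measurable_funB => //; apply: measurable_funM; apply: mo; by rewrite eq_sym.
- have -> : EFin \o ((fun x => x * x - cov2 (a, a)) \o xi a) =
     EFin \o (fun w => xi (a,a).1 w * xi (a,a).2 w + - cov2 (a, a)) by [].
  exact: intD.
- exact: (integrable_cprodM (a, a) (b, b)).
- have i0 : int (fun w => xi (a,a).1 w * xi (a,a).2 w + - cov2 (a, a)) by exact: intD.
  have /fineK <- : (\int[P]_w (xi a w * xi a w - cov2 (a, a))%:E \is a fin_num)%E.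
    exact: integrable_fin_num i0.
  congr (_%:E).
  apply: (etrans (RintegralB measurableT (int_xi2 (a, a)) (int_cst (cov2 (a, a))))).
  by rewrite Rintegral_probability_cst /cov2 subrr.
Qed.

Lemma cprod_swap p w : cprod (p.2, p.1) w = cprod p w.
Proof.
rewrite /cprod /cov2 /= mulrC; congr (_ - _).
by apply: eq_Rintegral => v _; rewrite mulrC.
Qed.

Lemma cprod_orth p q : q != p -> q != (p.2, p.1) ->
  \int[P]_w (cprod p w * cprod q w) = 0.
Proof.
have off p0 q0 : p0.1 != p0.2 -> q0 != p0 -> q0 != (p0.2, p0.1) ->
    \int[P]_w (cprod p0 w * cprod q0 w) = 0.
  case: p0 q0 => [a b] [u v] /= ab; rewrite !xpair_eqE => n1 n2.
  (* Since [(u, v)] is neither [(a, b)] nor [(b, a)], one of [a], [b] is absent from it;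
     [cprod_swap] reduces the case of [b] to that of [a]. *)
  have [/andP[au av]|/negPf nau] := boolP ((a != u) && (a != v)).
    exact: cprod_orth_off.
  under eq_Rintegral do rewrite -(cprod_swap (a, b)).
  apply: cprod_orth_off => /=; first by rewrite eq_sym.
    apply: contraFneq nau => bu; move: n1 n2 ab; rewrite -bu !eqxx /=.
    by rewrite ![_ == a]eq_sym; case: (a == v); rewrite ?andbF ?andbT //= => _ _; case: eqP.
  apply: contraFneq nau => bv; move: n1 n2 ab; rewrite -bv !eqxx /=.
    by rewrite ![_ == a]eq_sym; case: (a == u); rewrite ?andbF ?andbT //= => _ _; case: eqP.
move=> qp qs.
have [p12|] := eqVneq p.1 p.2; last by move=> ?; exact: off.
(* Here [p] is diagonal. If [q] is not, the roles are exchanged; otherwise both products are squares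
   of distinct variables. *)
have [q12|q12] := eqVneq q.1 q.2; last first.
  under eq_Rintegral do rewrite mulrC.
  apply: off => //; first by rewrite eq_sym.
  by apply: contraNneq q12 => pe; move: p12; rewrite pe /= => ->.
move: qp p12 q12; case: p {qs} => [a a']; case: q => [b b'] /= qp aa bb; subst a' b'.
by apply: cprod_orth_diag; apply: contraNneq qp => ->.
Qed.

Let sqr_sum_cprod (S : I * I -> R) w : (\sum_p S p * cprod p w) ^+ 2 =
  \sum_(pq : (I * I) * (I * I)) (S pq.1 * S pq.2) * (cprod pq.1 w * cprod pq.2 w).
Proof.
rewrite expr2 big_distrlr /= pair_big /=.
by apply: eq_bigr => pq _; rewrite mulrACA.
Qed.

Lemma integrable_quadratic_form (S : I * I -> R) :
  P.-integrable setT (EFin \o (fun w => (\sum_p S p * cprod p w) ^+ 2)).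
Proof.
have -> : EFin \o (fun w => (\sum_p S p * cprod p w) ^+ 2) =
    (fun w => \sum_(pq : (I * I) * (I * I))
      (EFin \o (fun v : T => (S pq.1 * S pq.2) * (cprod pq.1 v * cprod pq.2 v))%R) w)%E.
  by apply/funext => w /=; rewrite sumEFin sqr_sum_cprod.
by apply: integrable_sum => // pq _; apply: intZ; exact: integrable_cprodM.
Qed.

(** In the expanded square, [cprod_orth] leaves for each [p] only [p] and its transpose, each
    contributing at most [M * S p ^ 2]. Hence the factor 2. *)
Lemma variance_quadratic_form (S : I * I -> R) :
  (forall p, S (p.2, p.1) = S p) ->
  \int[P]_w ((\sum_p S p * cprod p w) ^+ 2) <= 2 * M * \sum_p S p ^+ 2.
Proof.
move=> Ssym.
under eq_Rintegral do rewrite sqr_sum_cprod.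
rewrite Rintegral_sum; last by move=> pq; apply: intZ; exact: integrable_cprodM.
under eq_bigr => pq _ do
  rewrite (RintegralZl _ measurableT (integrable_cprodM pq.1 pq.2)).
rewrite -(pair_big predT predT (fun p q => S p * S q *
  \int[P]_w (cprod p w * cprod q w))) /= mulr_sumr.
apply: ler_sum => p _.
have M0 : 0 <= M.
  apply: le_trans (cprod_sq_le p); apply: Rintegral_ge0 => w _.
  by rewrite -expr2 sqr_ge0.
have d0 : S p * S p * \int[P]_w (cprod p w * cprod p w) <= M * S p ^+ 2.
  by rewrite -expr2 mulrC ler_wpM2r ?sqr_ge0 ?cprod_sq_le.
have MS : 0 <= M * S p ^+ 2 by rewrite mulr_ge0 ?sqr_ge0.
rewrite (bigD1 p)//=.
have [sp|sp] := eqVneq (p.2, p.1) p.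
  rewrite big1 ?addr0; first by lra.
  by move=> q qp; rewrite cprod_orth ?mulr0// sp.
rewrite (bigD1 (p.2, p.1))//= big1 ?addr0; last first.
  by move=> q /andP[qp qs]; rewrite cprod_orth ?mulr0.
rewrite Ssym; under [X in _ + _ * X]eq_Rintegral do rewrite cprod_swap.
by lra.
Qed.
End Variance.
Arguments cov2 {R d T} P {I} xi p.
Arguments cprod {R d T} P {I} xi p w.

(** * Hermitian forms in a complex vector as real quadratic forms *)

Section QuadraticForm.
Context {R : realType}.

Lemma sum_quadratic_form (I J : finType) (e : J -> I -> R) (a : J -> R) (v : I -> R) :
  \sum_r a r * (\sum_i e r i * v i) ^+ 2 =
  \sum_(p : I * I) (\sum_r a r * (e r p.1 * e r p.2)) * (v p.1 * v p.2).
Proof.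
under [RHS]eq_bigr do rewrite mulr_suml.
rewrite exchange_big /=; apply: eq_bigr => r _.
rewrite expr2 big_distrlr /= pair_big /= mulr_sumr.
by apply: eq_bigr => p _; ring.
Qed.

(** Expanding the square, the sum over [p] factors into the product of two equal Gram entries, so
    only the terms with [r = s] survive. *)
Lemma orthonormal_frobenius (I J : finType) (e : J -> I -> R) (a : J -> R) :
  (forall r s, \sum_i e r i * e s i = (r == s)%:R) ->
  \sum_(p : I * I) (\sum_r a r * (e r p.1 * e r p.2)) ^+ 2 = \sum_r a r ^+ 2.
Proof.
move=> orth.
have E (p : I * I) : (\sum_r a r * (e r p.1 * e r p.2)) ^+ 2 =
    \sum_r \sum_s a r * a s * ((e r p.1 * e s p.1) * (e r p.2 * e s p.2)).
  rewrite expr2 big_distrlr /=; apply: eq_bigr => r _; apply: eq_bigr => s _; ring.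
under eq_bigr do rewrite E.
rewrite exchange_big /=; apply: eq_bigr => r _.
rewrite exchange_big /=.
have E2 s : \sum_(p : I * I) a r * a s * ((e r p.1 * e s p.1) * (e r p.2 * e s p.2)) =
    a r * a s * (r == s)%:R.
  rewrite -mulr_sumr -(pair_big predT predT (fun i k => e r i * e s i * (e r k * e s k))) /=.
  rewrite -big_distrlr /= !orth; by case: (r == s); rewrite ?mulr0 ?mulr1.
under eq_bigr do rewrite E2.
rewrite (bigD1 r)//= eqxx mulr1 big1 ?addr0 ?expr2//.
by move=> s sr; rewrite eq_sym (negbTE sr) mulr0.
Qed.

(** This discards the diagonal entry of the new column, which carries the index [None]. *)
Lemma mutually_independent_Some (d : measure_display) (T : measurableType d)
    (P : probability T R) (I : finType) (f : option I -> T -> R) :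
  mutually_independent P f -> mutually_independent P (f \o Some).
Proof.
move=> ind J B mB.
have := ind [set Some i | i in J]%SET (fun o => if o is Some i then B i else setT).
rewrite big_imset /=; last by move=> ? ? _ _ [].
have -> : \bigcap_(o in [set o | o \in [set Some i | i in J]%SET])
    f o @^-1` (if o is Some i then B i else setT) =
  \bigcap_(i in [set i | i \in J]) (f \o Some) i @^-1` B i.
  apply/seteqP; split=> w /= h.
    by move=> i iJ; apply: (h (Some i)); rewrite /= mem_imset// => ? ? [].
  by move=> o /= /imsetP[i iJ ->]; exact: h.
by apply; case.
Qed.

(* With [h = x + i y], the real and imaginary parts of the inner product of column
   [j] of [U] with [h] are the real inner products of [(x, y)] with rows
   [(j, false)] and [(j, true)]. *)
Definition real_rows (n : nat) (U : 'M[R[i]]_n) (r al : 'I_n * bool) : R :=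
  let u := U al.1 r.1 in
  if r.2 == al.2 then complex.Re u else if al.2 then complex.Im u else - complex.Im u.

Lemma sum_pair_bool (I : finType) (f : I * bool -> R) :
  \sum_al f al = \sum_k (f (k, true) + f (k, false)).
Proof.
transitivity (\sum_(al : I * bool) f (al.1, al.2)); first by apply: eq_bigr => -[].
rewrite -(pair_big predT predT (fun k b => f (k, b))) /=.
by apply: eq_bigr => k _; rewrite big_bool.
Qed.

Lemma Re_sum (I : finType) (f : I -> R[i]) :
  complex.Re (\sum_k f k) = \sum_k complex.Re (f k).
Proof. by apply: big_morph => // -[? ?] [? ?]. Qed.

Lemma Im_sum (I : finType) (f : I -> R[i]) :
  complex.Im (\sum_k f k) = \sum_k complex.Im (f k).
Proof. by apply: big_morph => // -[? ?] [? ?]. Qed.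

(** The real and imaginary parts of each entry of [adjmx U *m U = 1] are the inner products of two
    rows of equal, respectively different, boolean label, up to sign. *)
Lemma real_rows_orthonormal (n : nat) (U : 'M[R[i]]_n) :
  adjmx U *m U = 1%:M ->
  forall r s, \sum_al real_rows U r al * real_rows U s al = (r == s)%:R.
Proof.
move=> UU.
have E j k : \sum_(l < n) (complex.Re (U l j) * complex.Re (U l k) +
                     complex.Im (U l j) * complex.Im (U l k)) = (j == k)%:R /\
             \sum_(l < n) (complex.Re (U l j) * complex.Im (U l k) -
                     complex.Im (U l j) * complex.Re (U l k)) = 0.
  have := congr1 (fun A : 'M[R[i]]_n => A j k) UU; rewrite !mxE => e.
  split.
    transitivity (complex.Re ((j == k)%:R : R[i])); last by case: (j == k).
    rewrite -e Re_sum; apply: eq_bigr => l _; rewrite !mxE.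
    by case: (U l j) => u v; case: (U l k) => u' v' /=; ring.
  transitivity (complex.Im ((j == k)%:R : R[i])); last by case: (j == k).
  rewrite -e Im_sum; apply: eq_bigr => l _; rewrite !mxE.
  by case: (U l j) => u v; case: (U l k) => u' v' /=; ring.
move=> [j b] [k c]; have [e1 e2] := E j k.
rewrite sum_pair_bool /real_rows /= xpair_eqE.
case: b; case: c => /=; rewrite ?andbT ?andbF.
- by rewrite -e1; apply: eq_bigr => l _; ring.
- by apply: etrans e2; apply: eq_bigr => l _; ring.
- apply: oppr_inj; rewrite [RHS](_ : _ = 0) ?oppr0// -sumrN.
  by apply: etrans e2; apply: eq_bigr => l _; ring.
- by rewrite -e1; apply: eq_bigr => l _; ring.
Qed.

Lemma cabs2_real_rows (n : nat) (U : 'M[R[i]]_n) (j : 'I_n) (x y : 'I_n -> R) :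
  cabs2 (\sum_k (U k j)^* * (x k +i* y k)%C) =
  (\sum_al real_rows U (j, false) al * (if al.2 then y al.1 else x al.1)) ^+ 2 +
  (\sum_al real_rows U (j, true) al * (if al.2 then y al.1 else x al.1)) ^+ 2.
Proof.
rewrite /cabs2 Re_sum Im_sum !sum_pair_bool /real_rows /=; congr (_ ^+ 2 + _ ^+ 2).
  by apply: eq_bigr => k _; case: (U k j) => u v /=; ring.
by apply: eq_bigr => k _; case: (U k j) => u v /=; ring.
Qed.
End QuadraticForm.

(** [W] is the centred real quadratic form in the [2n] variables [X k], [Y k]. The constant 4 is the
    2 of [variance_quadratic_form] times 2, because each weight [a j] belongs to both rows
    [(j, false)] and [(j, true)]. *)
Lemma wigner_quadratic_form (R : realType) (d : measure_display) (T : measurableType d)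
    (P : probability T R) (beta n : nat) (M4 : R) (X Y : 'I_n -> T -> R) (D : T -> R)
    (U : 'M[R[i]]_n) (a : 'I_n -> R) :
  wigner_column P beta M4 X Y D -> adjmx U *m U = 1%:M ->
  exists W : T -> R,
    [/\ measurable_fun setT W, P.-integrable setT (EFin \o (fun w => W w ^+ 2)),
        \int[P]_w (W w ^+ 2) <= 4 * M4 * \sum_j a j ^+ 2
      & forall w, \sum_j a j * cabs2 (\sum_k (U k j)^* * (X k w +i* Y k w)%C) =
                  \sum_j a j + W w].
Proof.
move=> [[mX [mY mD]] ind _ mom var] UU.
pose xi (al : 'I_n * bool) := if al.2 then Y al.1 else X al.1.
have mxi al : measurable_fun setT (xi al) by case: al => k [] /=; [exact: mY|exact: mX].
have indxi : mutually_independent P xi.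
  have := mutually_independent_Some ind.
  by rewrite (_ : _ \o Some = xi)//; apply/funext => -[k []].
have xi1 al : (\int[P]_w (xi al w)%:E = 0)%E.
  by case: al => k []; have [] := mom k.
have xi4 al : (\int[P]_w (xi al w ^+ 4)%:E <= M4%:E)%E.
  have [_ _ h] := mom al.1; apply: le_trans h; apply: ge0_le_integral => //.
  - by move=> w _; rewrite lee_fin exprn_even_ge0.
  - by apply/measurable_EFinP; exact: measurable_funX.
  - apply/measurable_EFinP; apply: measurable_funX.
    by apply: measurable_funD; apply: measurable_funX.
  - move=> w _; rewrite lee_fin; case: al => k [] /=; rewrite /xi /=.
      have := sqr_ge0 (X k w); have := sqr_ge0 (Y k w); nra.
    have := sqr_ge0 (X k w); have := sqr_ge0 (Y k w); nra.
have v1 k : cov2 P xi ((k, true), (k, true)) + cov2 P xi ((k, false), (k, false)) = 1.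
  have RE (f : T -> R) (c : R) : Ex P (fun w => f w ^+ 2) = c%:E ->
      \int[P]_w (f w * f w) = c.
    move=> h; rewrite /Rintegral.
    have -> : (\int[P]_w (f w * f w)%:E = c%:E)%E by [].
    by [].
  rewrite /cov2 /xi /=; move: var; case: ifP => _ /(_ k) [].
    move=> /RE -> Y0; rewrite (RE _ 0) ?add0r// /Ex.
    by apply: integral0_eq => w _; rewrite Y0 expr0n.
  by move=> /RE -> /RE ->; lra.
pose e := real_rows U.
pose b (r : 'I_n * bool) := a r.1.
pose S (p : ('I_n * bool) * ('I_n * bool)) := \sum_r b r * (e r p.1 * e r p.2).
have Ssym p : S (p.2, p.1) = S p.
  by apply: eq_bigr => r _; rewrite /= [e r p.2 * _]mulrC.
exists (fun w => \sum_p S p * cprod P xi p w); split.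
- apply: measurable_sum => p; apply: measurable_funM => //.
  exact: measurable_cprod.
- exact: integrable_quadratic_form.
- apply: le_trans (variance_quadratic_form mxi indxi xi1 xi4 Ssym) _.
  rewrite orthonormal_frobenius; last exact: real_rows_orthonormal.
  rewrite sum_pair_bool /b /=.
  rewrite (_ : \sum_k _ = 2 * \sum_j a j ^+ 2); last first.
    by rewrite mulr_sumr; apply: eq_bigr => j _; ring.
  by lra.
- move=> w.
  have -> : \sum_j a j * cabs2 (\sum_k (U k j)^* * (X k w +i* Y k w)%C) =
      \sum_r b r * (\sum_al e r al * xi al w) ^+ 2.
    rewrite sum_pair_bool; apply: eq_bigr => j _; rewrite cabs2_real_rows mulrDr addrC.
    by congr (_ * _ ^+ 2 + _ * _ ^+ 2); apply: eq_bigr => -[k []] _.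
  rewrite sum_quadratic_form.
  (* The diagonal entries of [S] at [(k, true)] and [(k, false)] coincide, so only the sum [v1] of
     the two variances enters. It is 1 in the real and in the Hermitian case, which are thus treated
     together. *)
  have -> : \sum_j a j = \sum_p S p * cov2 P xi p.
    have dg al : \sum_be S (al, be) * cov2 P xi (al, be) = S (al, al) * cov2 P xi (al, al).
      rewrite (bigD1 al)//= big1 ?addr0// => be ba.
      by rewrite (cov2_neq mxi indxi xi1 xi4) ?mulr0//= eq_sym.
    rewrite -(pair_big predT predT (fun al be => S (al, be) * cov2 P xi (al, be)))/=.
    rewrite (eq_bigr (fun al => S (al, al) * cov2 P xi (al, al))); last first.
      by move=> al _; exact: dg.
    rewrite (eq_bigr (fun al => \sum_r b r * (e r al * e r al) * cov2 P xi (al, al)));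
      last by move=> al _; rewrite /S mulr_suml.
    rewrite exchange_big /= sum_pair_bool; apply: eq_bigr => j _.
    rewrite -big_split /= sum_pair_bool /b /=.
    have := real_rows_orthonormal UU (j, false) (j, false).
    rewrite eqxx sum_pair_bool /e /real_rows /= => o1.
    rewrite -[LHS]mulr1 -[X in _ * X]o1 mulr_sumr; apply: eq_bigr => k _.
    have -> : cov2 P xi ((k, true), (k, true)) = 1 - cov2 P xi ((k, false), (k, false)).
      by rewrite -(v1 k); ring.
    by ring.
  by rewrite -big_split /=; apply: eq_bigr => p _; rewrite -/(S p) /cprod; ring.
Qed.

(** * The semicircle law *)

Section Semicircle.
Context {R : realType}.
Notation mu := (@lebesgue_measure R).
Local Notation rho := (@rho_sc R).
Local Notation F := (@sc_cdf R).

(** [Num.sqrt] is 0 on negative numbers, which already cuts the density off outside [[-2, 2]]. *)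
Lemma rho_scE : rho = fun x => Num.sqrt (4 - x ^+ 2) / (2 * pi).
Proof.
apply/funext => x; rewrite /rho_sc; case: ifPn => // xN.
rewrite ler0_sqrtr ?mul0r// subr_le0; move: xN; rewrite negb_and -!ltNge.
by move=> /orP[] ?; nra.
Qed.

Lemma rho_sc_ge0 x : 0 <= rho x.
Proof. by rewrite rho_scE divr_ge0 ?sqrtr_ge0// mulr_ge0 ?pi_ge0. Qed.

Lemma rho_sc_le x a : 0 <= a -> 4 - x ^+ 2 <= (4 * a) ^+ 2 -> rho x <= a.
Proof.
move=> a0 xa; rewrite rho_scE; have pi2 := @pi_ge2 R.
rewrite ler_pdivrMr ?mulr_gt0 ?pi_gt0//.
apply: (@le_trans _ _ (4 * a)); last by nra.
by rewrite -[leRHS]ger0_norm ?mulr_ge0// -sqrtr_sqr ler_wsqrtr.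
Qed.

Lemma continuous_rho_sc : continuous rho.
Proof.
rewrite rho_scE => x; apply: cvgM; last exact: cvg_cst.
apply: (@continuous_comp _ _ _ (fun x : R => 4 - x ^+ 2) Num.sqrt);
  last exact: sqrt_continuous.
apply: cvgB; first exact: cvg_cst.
exact: exprn_continuous.
Qed.

Lemma integrable_rho_sc (D : set R) : measurable D -> mu.-integrable D (EFin \o rho).
Proof.
move=> mD; apply: (@integrableS _ _ _ mu setT) => //.
have -> : EFin \o rho = (EFin \o rho) \_ `[(-2), 2].
  apply/funext => x; rewrite patchE; case: ifPn => //; rewrite notin_setE /= in_itv /=.
  by rewrite /rho_sc => /negP/negbTE ->.
apply: (iffLR (integrable_mkcond _ _)) => //.
apply: (continuous_compact_integrable (f := rho)).
  exact: segment_compact.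
by apply: continuous_subspaceT => x; exact: continuous_rho_sc.
Qed.

Lemma integrable_rho_scZ (D : set R) c : measurable D ->
  mu.-integrable D (EFin \o (fun x => rho x * c)).
Proof.
move=> mD; have h := integrableZr _ c (integrable_rho_sc mD).
by apply: eq_integrable (h mD).
Qed.

Lemma sc_cdfB a b : a <= b -> F b - F a = \int[mu]_(x in `[a, b]) rho x.
Proof.
move=> ab; rewrite /sc_cdf Rintegral_itvB ?bnd_simp//; last exact: integrable_rho_sc.
by rewrite Rintegral_itv_obnd_cbnd//; exact: integrable_rho_sc.
Qed.

Lemma fine_lebesgue_itvcc (a b : R) : a <= b -> fine (mu `[a, b]) = b - a.
Proof.
move=> ab; rewrite lebesgue_measure_itv /= lte_fin.
by case: ltP => //= ba; have -> : a = b by [apply/eqP; rewrite eq_le ab ba]; rewrite subrr.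
Qed.

Lemma sc_cdfB_le a b c : a <= b -> (forall x, a <= x <= b -> rho x <= c) ->
  F b - F a <= c * (b - a).
Proof.
move=> ab rc; rewrite sc_cdfB// -fine_lebesgue_itvcc// -Rintegral_cst//.
apply: le_Rintegral => //; first exact: integrable_rho_sc.
  apply: continuous_compact_integrable; first exact: segment_compact.
  by apply: continuous_subspaceT => x; exact: cst_continuous.
Qed.

Lemma sc_cdf_nondecreasing a b : a <= b -> F a <= F b.
Proof.
by move=> ab; rewrite -subr_ge0 sc_cdfB// Rintegral_ge0// => x _; exact: rho_sc_ge0.
Qed.

Lemma sc_cdf_lipschitz a b : a <= b -> F b - F a <= b - a.
Proof.
move=> ab; rewrite -[leRHS]mul1r; apply: sc_cdfB_le => // x _.
by apply: rho_sc_le => //; nra.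
Qed.

Lemma sc_cdf_eq0 a : a <= -2 -> F a = 0.
Proof.
move=> a2; rewrite /sc_cdf /Rintegral integral0_eq// => x /=; rewrite in_itv /= => xa.
by rewrite rho_scE ler0_sqrtr ?mul0r//; nra.
Qed.

Lemma sc_cdf_sqr_le x : -2 <= x -> F x ^+ 2 <= (x + 2) ^+ 3.
Proof.
move=> x2; have y0 : 0 <= x + 2 by lra.
have b : F x <= Num.sqrt (x + 2) * (x + 2).
  have -> : F x = F x - F (-2) by rewrite (@sc_cdf_eq0 (-2)) ?subr0.
  rewrite -[X in _ * X](_ : x - (-2) = _); last by rewrite opprK.
  apply: sc_cdfB_le => // y /andP[y2 yx]; apply: rho_sc_le; first exact: sqrtr_ge0.
  by rewrite exprMn sqr_sqrtr//; nra.
have F0 : 0 <= F x by rewrite -(@sc_cdf_eq0 (-2))// sc_cdf_nondecreasing.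
have -> : (x + 2) ^+ 3 = (Num.sqrt (x + 2) * (x + 2)) ^+ 2.
  by rewrite exprMn sqr_sqrtr// -exprS.
by rewrite ler_pXn2r// nnegrE mulr_ge0// sqrtr_ge0.
Qed.

(* The antiderivative of [rho_sc x / (x + 2)] on [[-2, 2]] vanishing at [-2]; its
   value [1] at [2] is the Stieltjes transform of the semicircle law at the edge. *)
Definition sc_stieltjes (x : R) : R :=
  1 - (acos (x / 2) - Num.sqrt (4 - x ^+ 2) / 2) / pi.
Local Notation H := sc_stieltjes.

Lemma sc_stieltjes2 : H 2 = 1.
Proof.
rewrite /H divff// acos1 (_ : 4 - 2 ^+ 2 = 0 :> R) ?sqrtr0; last by lra.
by rewrite !mul0r subrr mul0r subr0.
Qed.

Lemma sc_stieltjesN2 : H (-2) = 0.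
Proof.
rewrite /H mulNr divff// acosN1 (_ : 4 - (- 2) ^+ 2 = 0 :> R) ?sqrtr0; last by lra.
by rewrite !mul0r subr0 divff ?subrr// gt_eqF// pi_gt0.
Qed.

(** At the endpoints, where [acos (x / 2)] is not differentiable, its continuity comes from being
    the inverse of the continuous map [2 * cos] on [[0, pi]]. *)
Lemma continuous_sc_stieltjes : {within `[-2, 2], continuous H}.
Proof.
have cacos : {within `[-2, 2], continuous (fun x : R => acos (x / 2))}.
  have := @segment_can_continuous R 0 pi (fun t => 2 * cos t)
    (fun x => acos (x / 2)) (pi_ge0 _).
  rewrite cos0 cospi mulr1 mulrN1 (_ : Order.min _ _ = -2); last first.
    by rewrite min_r//; lra.
  rewrite (_ : Order.max _ _ = 2); last by rewrite max_l//; lra.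
  apply.
    apply: continuous_subspaceT => x; apply: cvgM; first exact: cvg_cst.
    exact: continuous_cos.
  by move=> t t0; rewrite mulrAC divff// mul1r cosK.
move=> x; apply: cvgB; first exact: cvg_cst.
apply: cvgM; last exact: cvg_cst.
apply: cvgB; first exact: cacos.
apply: cvgM; last exact: cvg_cst.
apply: continuous_subspaceT => y.
apply: (@continuous_comp _ _ _ (fun x : R => 4 - x ^+ 2) Num.sqrt);
  last exact: sqrt_continuous.
apply: cvgB; first exact: cvg_cst.
exact: exprn_continuous.
Qed.

Lemma is_derive_sc_stieltjes (x : R) : -2 < x < 2 -> is_derive x 1 H (rho x / (x + 2)).
Proof.
move=> /andP[x1 x2].
have y1 : -1 < x / 2 < 1 by apply/andP; split; lra.
have s0 : 0 < 4 - x ^+ 2 by nra.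
have d1 : is_derive x 1 (fun y : R => y / 2) (2^-1).
  by apply: is_derive_eq; rewrite /GRing.scale /=; ring.
have d2 : is_derive x 1 (fun y : R => 4 - y ^+ 2) (- (2 * x)).
  by apply: is_derive_eq; rewrite /GRing.scale /=; ring.
have d3 := @is_derive1_comp R (@acos R) (fun y => y / 2) x _ _ (is_derive1_acos y1) d1.
have d4 := @is_derive1_comp R (@Num.sqrt R) (fun y => 4 - y ^+ 2) x _ _
  (is_derive1_sqrt s0) d2.
have -> : H = (cst 1 : R -> R) -
    (pi^-1 \*: ((@acos R \o (fun y : R => y / 2)) -
                (2^-1 \*: (@Num.sqrt R \o (fun y : R => 4 - y ^+ 2))))).
  apply/funext => y; rewrite /H /= !fctE /=.
  by rewrite /GRing.scale /= mulrC [2^-1 * _]mulrC.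
apply: is_derive_eq.
rewrite rho_scE /GRing.scale /=; set S := Num.sqrt (4 - x ^+ 2).
have S0 : 0 < S by rewrite sqrtr_gt0.
have -> : Num.sqrt (1 - (x / 2) ^+ 2) = S / 2.
  rewrite (_ : 1 - _ = (4 - x ^+ 2) * (2^-1) ^+ 2); last by field.
  by rewrite sqrtrM ?ltW// sqrtr_sqr ger0_norm.
have e : S ^+ 2 = (2 - x) * (x + 2) by rewrite sqr_sqrtr ?ltW//; ring.
have pi0 : pi != 0 :> R by rewrite gt_eqF// pi_gt0.
have S1 : S != 0 by rewrite gt_eqF.
have xp : x + 2 != 0 by rewrite gt_eqF//; lra.
move: (pi : R) pi0 => q pi0.
have -> : S / (2 * q) / (x + 2) = S ^+ 2 / (2 * q * (x + 2) * S).
  by field; rewrite S1 xp pi0.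
by rewrite e; field; rewrite S1 xp pi0.
Qed.

(** Fundamental theorem of calculus. Taking [a] strictly above -2 keeps the integrand continuous on
    [[a, b]]; at [b = 2] the continuity of [H] suffices. *)
Lemma sc_stieltjesB (a b : R) : -2 < a -> a < b -> b <= 2 ->
  H b - H a = \int[mu]_(x in `[a, b]) (rho x / (x + 2)) /\
  mu.-integrable `[a, b] (EFin \o (fun x => rho x / (x + 2))).
Proof.
move=> a2 ab b2.
have cf : {within `[a, b], continuous (fun x => rho x / (x + 2))}.
  apply: continuous_in_subspaceT => x; rewrite inE /= in_itv /= => /andP[ax xb].
  apply: cvgM; first exact: continuous_rho_sc.
  apply: cvgV; first by rewrite gt_eqF//; lra.
  by apply: cvgD; [exact: cvg_id|exact: cvg_cst].
have cH : {within `[a, b], continuous H}.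
  apply: continuous_subspaceW continuous_sc_stieltjes.
  by apply: subset_itv; rewrite bnd_simp// ltW.
split; last first.
  apply: (continuous_compact_integrable (f := fun x => rho x / (x + 2))) => //.
  exact: segment_compact.
have [c1 c2 c3] := (continuous_within_itvP H ab).1 cH.
rewrite /Rintegral (continuous_FTC2 (F := H) ab cf)//.
- split=> // x; rewrite in_itv /= => /andP[ax xb].
  have := @is_derive_sc_stieltjes x; case => //.
  by apply/andP; split; lra.
- move=> x; rewrite in_itv /= => /andP[ax xb]; rewrite derive1E.
  apply: derive_val; apply: is_derive_sc_stieltjes; apply/andP; split; lra.
Qed.

Lemma sc_stieltjesB_le (a b : R) : -2 < a -> a <= b -> b <= 2 ->
  H b - H a <= (F b - F a) / (a + 2).
Proof.
move=> a2 ab b2; have [->|anb] := eqVneq a b; first by rewrite !subrr mul0r.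
have {anb}ab : a < b by rewrite lt_neqAle anb.
have [-> ig] := sc_stieltjesB a2 ab b2.
rewrite (sc_cdfB (ltW ab)) -RintegralZr//; last exact: integrable_rho_sc.
apply: le_Rintegral => //; first exact: integrable_rho_scZ.
move=> x /=; rewrite in_itv /= => /andP[ax xb].
rewrite ler_wpM2l ?rho_sc_ge0// lef_pV2 ?posrE; lra.
Qed.

Lemma sc_stieltjesB_ge (a b : R) : -2 < a -> a <= b -> b <= 2 ->
  (F b - F a) / (b + 2) <= H b - H a.
Proof.
move=> a2 ab b2; have [->|anb] := eqVneq a b; first by rewrite !subrr mul0r.
have {anb}ab : a < b by rewrite lt_neqAle anb.
have [-> ig] := sc_stieltjesB a2 ab b2.
rewrite (sc_cdfB (ltW ab)) -RintegralZr//; last exact: integrable_rho_sc.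
apply: le_Rintegral => //; first exact: integrable_rho_scZ.
move=> x /=; rewrite in_itv /= => /andP[ax xb].
rewrite ler_wpM2l ?rho_sc_ge0// lef_pV2 ?posrE; lra.
Qed.

(** The difference [K] vanishes at -2 and is nondecreasing, because [rho y <= sqrt (y + 2) / 2].
    This controls [H] next to -2, where [1 / (x + 2)] is unbounded. *)
Lemma sc_stieltjes_le_sqrt x : -2 <= x <= 2 -> H x <= Num.sqrt (x + 2).
Proof.
move=> /andP[x1 x2].
pose K (y : R) := Num.sqrt (y + 2) - H y.
have dK (y : R) : -2 < y < 2 -> is_derive y 1 K ((2 * Num.sqrt (y + 2))^-1 - rho y / (y + 2)).
  move=> y2; apply: is_deriveB; last exact: is_derive_sc_stieltjes.
  have y20 : 0 < y + 2 by lra.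
  have d0 : is_derive y 1 (fun t : R => t + 2) 1.
    by apply: is_derive_eq; rewrite addr0.
  have := @is_derive1_comp R (@Num.sqrt R) (fun t => t + 2) y _ _ (is_derive1_sqrt y20) d0.
  by rewrite mulr1.
rewrite -subr_ge0 -/(K x).
have <- : K (-2) = 0 by rewrite /K sc_stieltjesN2 addNr sqrtr0 subrr.
apply: (@ger0_derive1_le_cc R K (-2) 2) => //.
- by move=> y; rewrite in_itv /= => /dK[].
- move=> y; rewrite in_itv /= => y2; rewrite derive1E.
  have -> := @derive_val _ _ _ _ _ _ _ (dK y y2).
  have y20 : 0 < y + 2 by move: y2 => /andP[]; lra.
  set s := Num.sqrt (y + 2).
  have s0 : 0 < s by rewrite sqrtr_gt0.
  have s2 : s ^+ 2 = y + 2 by rewrite sqr_sqrtr// ltW.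
  have rs : rho y <= s / 2.
    apply: rho_sc_le; first by rewrite divr_ge0// ltW.
    by rewrite !exprMn s2; move: y2 => /andP[]; nra.
  rewrite subr_ge0 -s2 (_ : (2 * s)^-1 = (s / 2) / s ^+ 2); last by field; rewrite gt_eqF.
  by rewrite ler_wpM2r// invr_ge0 sqr_ge0.
- move=> y; apply: cvgB; last exact: continuous_sc_stieltjes.
  apply: continuous_subspaceT => {}y.
  apply: (@continuous_comp _ _ _ (fun x : R => x + 2) Num.sqrt); last exact: sqrt_continuous.
  by apply: cvgD; [exact: cvg_id|exact: cvg_cst].
- by rewrite in_itv /= lexx; lra.
- by rewrite in_itv /= x1 x2.
Qed.
End Semicircle.

(** * Sums over the spectrum near the edge *)

Section EdgeSum.
Context {R : realType}.
Local Notation F := (@sc_cdf R).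

Lemma sc_cdf_ge2 (x : R) : 2 <= x -> F x = F 2.
Proof.
move=> x2; apply: le_anti; rewrite (sc_cdf_nondecreasing x2) andbT -subr_le0.
rewrite -[leRHS](mul0r (x - 2)); apply: sc_cdfB_le => // y /andP[y2 _].
by rewrite rho_scE ler0_sqrtr ?mul0r//; nra.
Qed.

(** The extension is constant beyond 2, since the largest rescaled eigenvalues may exceed 2. *)
Definition sc_edge (x : R) : R := sc_stieltjes (Num.min x 2).
Local Notation H := sc_edge.

Lemma sc_edgeB_le (a b : R) : -2 < a -> a <= b -> H b - H a <= (F b - F a) / (a + 2).
Proof.
move=> a2 ab; rewrite /H.
have [b2|/ltW b2] := leP b 2; have [aa|/ltW aa] := leP a 2.
- exact: sc_stieltjesB_le.
- have -> : b = 2 by lra.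
  by rewrite subrr divr_ge0 ?subr_ge0; [|apply: sc_cdf_nondecreasing; lra|lra].
- by rewrite (sc_cdf_ge2 b2); exact: sc_stieltjesB_le.
- by rewrite subrr divr_ge0 ?subr_ge0 ?sc_cdf_nondecreasing//; lra.
Qed.

Lemma sc_edgeB_ge (a b : R) : -2 < a -> a <= b -> (F b - F a) / (b + 2) <= H b - H a.
Proof.
move=> a2 ab; rewrite /H.
have [b2|/ltW b2] := leP b 2; have [aa|/ltW aa] := leP a 2.
- exact: sc_stieltjesB_ge.
- have -> : b = 2 by lra.
  by rewrite (sc_cdf_ge2 aa) !subrr mul0r.
- rewrite (sc_cdf_ge2 b2); apply: le_trans (sc_stieltjesB_ge a2 aa (lexx 2)).
  apply: ler_wpM2l; first by rewrite subr_ge0 sc_cdf_nondecreasing.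
  by rewrite lef_pV2 ?posrE; lra.
- by rewrite (sc_cdf_ge2 b2) (sc_cdf_ge2 aa) !subrr mul0r.
Qed.

Lemma sc_edge_ge0 (x : R) : -2 <= x -> 0 <= H x.
Proof.
move=> x2; rewrite /H /sc_stieltjes; set y := Num.min x 2.
have y2 : -2 <= y <= 2 by rewrite /y; have [xx|xx] := leP x 2; apply/andP; split; lra.
rewrite subr_ge0 ler_pdivrMr ?pi_gt0// mul1r.
have : acos (y / 2) <= pi :> R.
  by move: y2 => /andP[ya yb]; apply: acos_lepi; apply/andP; split; lra.
have := sqrtr_ge0 (4 - y ^+ 2) => s0 a0.
by rewrite lerBlDr (le_trans a0)// lerDl divr_ge0.
Qed.

Lemma card_ord_ltn n m : (m <= n)%N -> #|[set i : 'I_n | (i < m)%N]%SET| = m.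
Proof.
move=> mn; rewrite -sum1dep_card -(big_ord_widen n (fun=> 1%N) mn).
by rewrite sum_nat_const card_ord muln1.
Qed.

Section Counting.
Variables (n : nat) (V : R) (x : nat -> R).
Hypothesis n0 : (0 < n)%N.
Hypothesis xmono : forall j k, (1 <= j <= k)%N -> (k <= n)%N -> x j <= x k.
Hypothesis count : forall E,
  `|#|[set j : 'I_n | x j.+1 <= E]%SET|%:R - n%:R * F E| <= V.

Lemma count_ge j : (1 <= j <= n)%N -> j%:R - V <= n%:R * F (x j).
Proof.
move=> /andP[j1 jn]; have := count (x j); rewrite ler_norml => /andP[_].
have : j%:R <= #|[set k : 'I_n | x k.+1 <= x j]%SET|%:R :> R.
  rewrite ler_nat -[X in (X <= _)%N](card_ord_ltn jn); apply/subset_leq_card.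
  by apply/fintype.subsetP => k; rewrite !inE => kj; apply: xmono.
lra.
Qed.

(* Ties are avoided by counting just below [x j], at the cost of the continuity of [F]. *)
Lemma count_le j : (1 <= j <= n)%N -> n%:R * F (x j) <= j.-1%:R + V.
Proof.
move=> /andP[j1 jn]; have n0' : 0 < n%:R :> R by rewrite ltr0n.
apply/ler_addgt0Pr => e e0.
have e1 : 0 < e / n%:R by rewrite divr_gt0.
have := count (x j - e / n%:R); rewrite ler_norml => /andP[+ _].
have : #|[set k : 'I_n | x k.+1 <= x j - e / n%:R]%SET|%:R <= j.-1%:R :> R.
  rewrite ler_nat -[X in (_ <= X)%N](@card_ord_ltn n j.-1); last first.
    by rewrite (leq_trans (leq_pred _)).
  apply: subset_leq_card; apply/fintype.subsetP => k; rewrite !inE; apply: contraLR.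
  rewrite -leqNgt -ltNge => jk; rewrite (@lt_le_trans _ _ (x j))//; first lra.
  by apply: xmono => //; rewrite j1 /= -(prednK j1) ltnS.
have : F (x j) - F (x j - e / n%:R) <= e / n%:R.
  by apply: le_trans (sc_cdf_lipschitz _) _; lra.
rewrite -(@ler_pM2l _ n%:R)// mulrBr mulrCA divff ?gt_eqF// mulr1; lra.
Qed.

Let phi j := (x j + 2)^-1.
Let Psi j := H (x j) + phi j * (j%:R / n%:R - F (x j)).

(** With [q], [q'] the values of [phi] and [f], [f'] those of [F] at [m] and [m.+1], and [u = m/n],
    the increment of [Psi] minus [q' / n] lies between [(q - q') (f - u)] and [(q - q') (f' - u)].
    The counting estimate bounds both by [(q - q') V / n] in absolute value, and these bounds
    telescope. *)
Lemma edge_sum_telescope p m : (1 <= p)%N -> (p <= m)%N -> (m <= n)%N -> -2 < x p ->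
  `|\sum_(p <= j < m) phi j.+1 / n%:R - (Psi m - Psi p)| <= (phi p - phi m) * (V / n%:R).
Proof.
move=> p1; elim: m => [|m IH] pm mn xp.
  by move: p1; rewrite (eqP (_ : p == 0%N)) -?leqn0.
have n0' : 0 < n%:R :> R by rewrite ltr0n.
move: pm; rewrite leq_eqVlt => /predU1P[->|]; first by rewrite big_geq// !subrr normr0 mul0r.
rewrite ltnS => pm; rewrite big_nat_recr//=.
have m1 : (1 <= m)%N by apply: leq_trans pm.
have xm : -2 < x m.
  by apply: (lt_le_trans xp); apply: xmono; rewrite ?p1 ?pm// ltnW.
have xm' : x m <= x m.+1 by apply: xmono; rewrite ?m1 /=.
have hu := sc_edgeB_le xm xm'; have hl := sc_edgeB_ge xm xm'.
have cl : m%:R / n%:R - V / n%:R <= F (x m).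
  by rewrite -mulrBl ler_pdivrMr// mulrC count_ge// m1 ltnW.
(* [count_le] at [m.+1] involves the predecessor [m], so both ends of the step are compared with the
   same value [m/n]. *)
have cu : F (x m.+1) <= m%:R / n%:R + V / n%:R.
  by rewrite -mulrDl ler_pdivlMr// mulrC (@count_le m.+1).
have := IH pm (ltnW mn) xp; rewrite !ler_norml.
have ff := sc_cdf_nondecreasing xm'.
have pp : phi m.+1 <= phi m by rewrite /phi lef_pV2 ?posrE; lra.
rewrite /Psi (_ : m.+1%:R / n%:R = m%:R / n%:R + n%:R^-1); last by rewrite -natr1 mulrDl mul1r.
move: hu hl; rewrite -/(phi m) -/(phi m.+1).
move: n%:R^-1 (F (x m)) (F (x m.+1)) (H (x m)) (H (x m.+1)) (phi m) (phi m.+1)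
  (V / n%:R) (m%:R / n%:R) (H (x p) + _) (\sum_(_ <= _ < _) _) pp cl cu ff.
move=> w f f' h h' q q' v u P0 S pp cl cu ff hu hl /andP[i1 i2].
have k1 : 0 <= (q - q') * (f - (u - v)) by rewrite mulr_ge0; lra.
have k2 : 0 <= (q - q') * (u + v - f') by rewrite mulr_ge0; lra.
by apply/andP; split; lra.
Qed.

(** [Psi n] is close to 1 and [Psi p] to [H (x p)]. In units of [phi p * V / n], the 5 allows 1 for
    the telescoping, 1 for the correction at each of [p] and [n], and 2 for [1 - H (x n)]. *)
Lemma edge_sum p : (1 <= p <= n)%N -> -2 < x p ->
  `|\sum_(p <= j < n) phi j.+1 / n%:R - (1 - H (x p))| <= 5 * (phi p * (V / n%:R)).
Proof.
move=> /andP[p1 pn] xp.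
have n0' : 0 < n%:R :> R by rewrite ltr0n.
have n1 : (1 <= n <= n)%N by rewrite n0 leqnn.
have := edge_sum_telescope p1 pn (leqnn n) xp.
have xpn : x p <= x n by apply: xmono; rewrite ?p1.
have V0 : 0 <= V by apply: le_trans (count 0).
have v0 : 0 <= V / n%:R by rewrite divr_ge0// ltW.
have php : 0 < phi p by rewrite invr_gt0; lra.
have phn : 0 < phi n by rewrite invr_gt0; lra.
have php' : phi n <= phi p by rewrite /phi lef_pV2 ?posrE; lra.
have cb j : (1 <= j <= n)%N -> `|j%:R / n%:R - F (x j)| <= V / n%:R.
  move=> jn; have := count_ge jn; have := count_le jn => cl cu.
  have {}cl : n%:R * F (x j) <= j%:R + V.
    by apply: le_trans cl _; rewrite lerD2r ler_nat leq_pred.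
  rewrite ler_norml; apply/andP; split.
    rewrite lerBrDl lerBlDr -mulrDl ler_pdivlMr// mulrC; lra.
  rewrite lerBlDr -lerBlDl -mulrBl ler_pdivrMr// mulrC; lra.
have H1 : 0 <= 1 - H (x n) <= phi n * (2 * (V / n%:R)).
  have [xn2|/ltW xn2] := leP (x n) 2; last first.
    rewrite /H min_r// sc_stieltjes2 subrr lexx /=.
    by rewrite mulr_ge0// ?(ltW phn)// mulr_ge0.
  have H2 : H 2 = 1 by rewrite /H minxx sc_stieltjes2.
  rewrite (_ : 1 - H (x n) = H 2 - H (x n)); last by rewrite H2.
  have xn : -2 < x n by lra.
  have hl := sc_edgeB_ge xn xn2; have hu := sc_edgeB_le xn xn2.
  have F0 := sc_cdf_nondecreasing xn2.
  apply/andP; split; first by apply: le_trans hl; rewrite divr_ge0; lra.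
  apply: le_trans hu _; rewrite mulrC ler_pM2l//.
  have := cb n n1; rewrite ler_norml divff ?gt_eqF// => /andP[_ +].
  (* The total mass is not computed: the count at [E = 2], which is at most [n], bounds [F 2] with
     an admissible error. *)
  suff : F 2 <= 1 + V / n%:R by lra.
  have := count 2; rewrite ler_norml => /andP[+ _].
  have : #|[set j : 'I_n | x j.+1 <= 2]%SET|%:R <= n%:R :> R.
    by rewrite ler_nat -[X in (_ <= X)%N]card_ord max_card.
  move=> c1 c2; rewrite -(@ler_pM2l _ n%:R)// mulrDr mulr1 mulrCA divff ?gt_eqF// mulr1.
  lra.
have := cb n n1; have := cb p; rewrite p1 pn => /(_ isT).
rewrite /Psi !ler_norml.
move: (\sum_(_ <= _ < _) _) (H (x n)) (H (x p)) H1 => S hn hp /andP[H1 H2].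
move: (n%:R / n%:R - _) (p%:R / n%:R - _) (phi p) (phi n) php phn php' (V / n%:R) v0 H2.
move=> en ep q q' q0 q0' qq v v0 H2 /andP[e1 e2] /andP[e3 e4] /andP[i1 i2].
have k1 : 0 <= q * (ep + v) by rewrite mulr_ge0; lra.
have k2 : 0 <= q * (v - ep) by rewrite mulr_ge0; lra.
have k3 : 0 <= q' * (en + v) by rewrite mulr_ge0; lra.
have k4 : 0 <= q' * (v - en) by rewrite mulr_ge0; lra.
have k5 : 0 <= (q - q') * v by rewrite mulr_ge0; lra.
by apply/andP; split; lra.
Qed.
End Counting.
End EdgeSum.

(** * Edge sums in the scale [t = n^(1/6)], with all polylogarithmic factors absorbed in [V] *)

Section EdgeEstimates.
Context {R : realType}.
Local Notation F := (@sc_cdf R).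
Local Notation H := (@sc_edge R).

Variables (n i : nat) (V t z : R) (lam : nat -> R).
Hypothesis t1 : 1 <= t.
Hypothesis tn : t ^+ 6 = n%:R.
Hypothesis V100 : 100 <= V.
Hypothesis Vn : V ^+ 3 <= n%:R.
Hypothesis harm : \sum_(0 <= j < n) (j.+1%:R)^-1 <= V.
Hypothesis iV : i%:R <= V.
Hypothesis lam_mono : forall j k, (1 <= j <= k)%N -> (k <= n)%N -> lam j <= lam k.
Hypothesis count : forall E : R,
  `|#|[set j : 'I_n | lam j.+1 <= E * t ^+ 3]%SET|%:R - n%:R * F E| <= V.
Hypothesis zt : `|z + 2 * t ^+ 3| <= V / t.
Hypothesis gap : forall j, (1 <= j <= n)%N -> j != i.-1 -> j != i ->
  (V * t)^-1 <= `|lam j - z|.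

Let t0 : 0 < t. Proof. exact: lt_le_trans ltr01 t1. Qed.
Let V0 : 0 < V. Proof. by apply: lt_le_trans V100. Qed.
Let t30 : 0 < t ^+ 3. Proof. exact: exprn_gt0. Qed.

Let x j := lam j / t ^+ 3.

Let xmono j k : (1 <= j <= k)%N -> (k <= n)%N -> x j <= x k.
Proof. by move=> jk kn; rewrite ler_pM2r ?invr_gt0// lam_mono. Qed.

Let xcount E : `|#|[set j : 'I_n | x j.+1 <= E]%SET|%:R - n%:R * F E| <= V.
Proof.
have -> : [set j : 'I_n | x j.+1 <= E]%SET = [set j : 'I_n | lam j.+1 <= E * t ^+ 3]%SET.
  by apply/setP => j; rewrite !inE ler_pdivrMr.
exact: count.
Qed.

Let n0 : (0 < n)%N.
Proof. by rewrite -(ltr0n R) -tn exprn_gt0. Qed.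

(* The edge variable: [lam j = t^3 (-2 + Y j / t^4)], so that [Y j] is of order [j^(2/3)]. *)
Let Y j := (x j + 2) * t ^+ 4.

(** The threshold gives [j - V >= V^2] and [j - V >= j / 2]. Counting and [sc_cdf_sqr_le] give
    [(j - V)^2 <= Y j ^ 3], whence both lower bounds on [Y j]. The bound [j / 4] on its square,
    weaker than the true order [j^(4/3)], is enough for a harmonic sum. *)
Let large j : (j <= n)%N -> V ^+ 2 + V <= j%:R ->
  [/\ -2 < x j, 2 * V <= Y j & j%:R / 4 <= Y j ^+ 2].
Proof.
have [HV HV0 Ht Ht0] : [/\ 100 <= V, 0 < V, 1 <= t & 0 < t] by [].
move=> jn jV.
have j1 : (1 <= j <= n)%N.
  by rewrite jn andbT -(ltr0n R); apply: lt_le_trans jV; nra.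
have cg := count_ge xmono xcount j1.
have n0' : 0 < n%:R :> R by rewrite ltr0n.
have F0 : 0 < F (x j).
  by rewrite -(pmulr_rgt0 _ n0'); apply: lt_le_trans cg; nra.
have x2 : -2 < x j.
  by rewrite ltNge; apply: contraTN F0 => /sc_cdf_eq0 ->; rewrite ltxx.
have Y0 : 0 < Y j by rewrite mulr_gt0 ?exprn_gt0//; lra.
have Y3 : (j%:R - V) ^+ 2 <= Y j ^+ 3.
  have jV0 : 0 <= j%:R - V by nra.
  apply: (@le_trans _ _ ((n%:R * F (x j)) ^+ 2)).
    by rewrite ler_pXn2r// ?nnegrE// (le_trans jV0).
  have -> : Y j ^+ 3 = n%:R ^+ 2 * (x j + 2) ^+ 3 by rewrite /Y -tn; ring.
  by rewrite exprMn ler_pM2l ?exprn_gt0//; apply: sc_cdf_sqr_le; exact: ltW.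
have jV2 : 0 < V ^+ 2 by rewrite exprn_gt0.
split=> //.
- rewrite -(@ler_pXn2r _ 3)// ?nnegrE ?(ltW Y0)//; last by nra.
  apply: le_trans Y3; apply: (@le_trans _ _ ((V ^+ 2) ^+ 2)); first by nra.
  by rewrite ler_pXn2r// ?nnegrE; nra.
- have j0 : 1 <= j%:R :> R by rewrite ler1n; case/andP: j1.
  rewrite -(@ler_pXn2r _ 3)// ?nnegrE ?divr_ge0// ?sqr_ge0//.
  have -> : (Y j ^+ 2) ^+ 3 = (Y j ^+ 3) ^+ 2 by ring.
  apply: (@le_trans _ _ (((j%:R / 2) ^+ 2) ^+ 2)).
    have := exprn_ge0 3 (le_trans ler01 j0); set w := j%:R; move=> w3.
    by have : 0 <= w ^+ 3 * (w - 1) by [rewrite mulr_ge0//; lra]; lra.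
  rewrite ler_pXn2r// ?nnegrE ?sqr_ge0 ?exprn_ge0 ?(ltW Y0)//.
  by apply: le_trans Y3; rewrite ler_pXn2r// ?nnegrE; nra.
Qed.

Let a j := (lam j - z)^-1.
Let zeta := (z + 2 * t ^+ 3) * t.

Let zetaV : `|zeta| <= V.
Proof. by rewrite normrM (ger0_norm (ltW t0)) -ler_pdivlMr. Qed.

Let aE j : a j = t / (Y j - zeta).
Proof.
rewrite /a -[LHS]mul1r; have tn0 : t != 0 by rewrite gt_eqF.
have -> : Y j - zeta = t * (lam j - z) by rewrite /Y /zeta /x; field.
by rewrite invfM mulrA divff.
Qed.

(** As [Y j >= 2 V >= 2 |zeta|], the denominator [Y j - zeta] is at least [Y j / 2]; both quantities
    are then of order [(Y j)^-2], which is at most [4 / j]. *)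
Let tail_bounds j : (j <= n)%N -> V ^+ 2 + V <= j%:R ->
  `|a j - t / Y j| <= 8 * t * V * (j%:R)^-1 /\ a j ^+ 2 <= 16 * t ^+ 2 * (j%:R)^-1.
Proof.
have [HV HV0 Ht Ht0] : [/\ 100 <= V, 0 < V, 1 <= t & 0 < t] by [].
move=> jn jV; have [x2 YV Yj] := large jn jV.
have j0 : 0 < j%:R :> R by apply: lt_le_trans jV; nra.
move: zetaV; rewrite ler_norml => /andP[z1 z2].
have Y0 : 0 < Y j by lra.
have Yz : 0 < Y j - zeta by lra.
have Y2 : (Y j ^+ 2)^-1 <= 4 / j%:R.
  rewrite -[X in X <= _]mul1r ler_pdivrMr ?exprn_gt0// mulrAC ler_pdivlMr// mul1r; lra.
have iY : (Y j - zeta)^-1 <= 2 / Y j.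
  by rewrite -[X in X <= _]mul1r ler_pdivrMr// mulrAC ler_pdivlMr//; lra.
have iY0 : 0 < (Y j - zeta)^-1 by rewrite invr_gt0.
have Yi0 : 0 < (Y j)^-1 by rewrite invr_gt0.
split.
- have -> : a j - t / Y j = zeta * (t * ((Y j - zeta)^-1 * (Y j)^-1)).
    by rewrite aE; field; rewrite !gt_eqF.
  rewrite normrM [X in _ * X]ger0_norm; last first.
    by rewrite !mulr_ge0// ltW.
  apply: (@le_trans _ _ (V * (t * (2 * (Y j ^+ 2)^-1)))).
    apply: ler_pM => //; first by rewrite !mulr_ge0// ltW.
    by rewrite ler_pM2l// -exprVn expr2 mulrA ler_pM2r.
  have -> : 8 * t * V * (j%:R)^-1 = V * (t * (2 * (4 / j%:R))) by ring.
  by rewrite !ler_pM2l.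
- rewrite aE exprMn -mulrA [leRHS](_ : _ = t ^+ 2 * (4 * (4 / j%:R))); last by ring.
  rewrite ler_pM2l ?exprn_gt0//.
  apply: (@le_trans _ _ (4 * (Y j ^+ 2)^-1)); last by rewrite ler_pM2l.
  have -> : 4 * (Y j ^+ 2)^-1 = (2 / Y j) ^+ 2 by field; rewrite gt_eqF.
  by rewrite ler_pXn2r// nnegrE ltW// mulr_gt0.
Qed.

Let head_bound j : (1 <= j <= n)%N -> j != i.-1 -> j != i -> `|a j| <= V * t.
Proof.
move=> jn j1 j2; have g := gap jn j1 j2.
have Vt : 0 < V * t by rewrite mulr_gt0.
have l0 : 0 < `|lam j - z| by apply: lt_le_trans g; rewrite invr_gt0.
by rewrite /a normfV -[leRHS]invrK lef_pV2 ?posrE ?invr_gt0.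
Qed.

Lemma edge_estimates :
  `|\sum_(j < n | (j.+1 != i.-1) && (j.+1 != i)) (lam j.+1 - z)^-1 - t ^+ 3| <= V ^+ 4 * t /\
  \sum_(j < n | (j.+1 != i.-1) && (j.+1 != i)) (lam j.+1 - z)^-1 ^+ 2 <= V ^+ 5 * t ^+ 2.
Proof.
have [HV HV0 Ht Ht0] : [/\ 100 <= V, 0 < V, 1 <= t & 0 < t] by [].
pose p := (Num.truncn (V ^+ 2 + V)).+1.
have [p1 p2] : V ^+ 2 + V <= p%:R /\ p%:R <= V ^+ 2 + V + 1.
  have V2 : 0 <= V ^+ 2 + V by nra.
  have /andP[h1 h2] := truncn_itv V2.
  by split; [exact: ltW|rewrite /p -natr1; lra].
have pn : (p <= n)%N.
  by rewrite -(ler_nat R) (le_trans p2)// (le_trans _ Vn)//; nra.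
have ip : (i <= p)%N by rewrite -(ler_nat R) (le_trans iV)// (le_trans _ p1)//; nra.
have [xp Yp _] := large pn p1.
have tail j : (p <= j < n)%N -> V ^+ 2 + V <= j.+1%:R.
  by move=> /andP[pj _]; apply: le_trans p1 _; rewrite ler_nat ltnW.
pose Q j := (j.+1 != i.-1) && (j.+1 != i).
have Qtail j : (p <= j)%N -> Q j.
  move=> pj; rewrite /Q !gtn_eqF//; first by rewrite ltnS (leq_trans ip).
  by rewrite ltnS (leq_trans (leq_pred i))// (leq_trans ip).
have split_sum (f : nat -> R) : \sum_(j < n | Q j) f j =
    \sum_(0 <= j < p | Q j) f j + \sum_(p <= j < n) f j.
  rewrite -(big_mkord Q f) (big_cat_nat _ pn)//=; congr (_ + _).
  rewrite [LHS]big_nat_cond [RHS]big_nat_cond; apply: eq_bigl => j.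
  by case: (leqP p j) => //= pj; rewrite Qtail.
have harm' : \sum_(p <= j < n) (j.+1%:R)^-1 <= V.
  apply: le_trans harm; rewrite [leRHS](big_cat_nat (leq0n p) pn)//= lerDr.
  by apply: sumr_ge0 => j _; rewrite invr_ge0.
have head_abs : \sum_(0 <= j < p | Q j) `|a j.+1| <= p%:R * (V * t).
  apply: (@le_trans _ _ (\sum_(0 <= j < p) (V * t))).
    rewrite [leRHS](bigID Q)/= ler_wpDr//.
      by apply: sumr_ge0 => j _; rewrite mulr_ge0// ltW.
    rewrite big_nat_cond [leRHS]big_nat_cond.
    apply: ler_sum => j /andP[/andP[_ jp] /andP[j1 j2]].
    by apply: head_bound => //; rewrite /= (leq_trans jp).
  by rewrite sumr_const_nat subn0 mulr_natl.
have head_sq : \sum_(0 <= j < p | Q j) a j.+1 ^+ 2 <= p%:R * (V * t) ^+ 2.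
  apply: (@le_trans _ _ (\sum_(0 <= j < p) (V * t) ^+ 2)).
    rewrite [leRHS](bigID Q)/= ler_wpDr//.
      by apply: sumr_ge0 => j _; exact: sqr_ge0.
    rewrite big_nat_cond [leRHS]big_nat_cond.
    apply: ler_sum => j /andP[/andP[_ jp] /andP[j1 j2]].
    rewrite -real_normK ?num_real// ler_pXn2r ?nnegrE ?mulr_ge0 ?(ltW V0) ?(ltW t0)//.
    by apply: head_bound => //; rewrite /= (leq_trans jp).
  by rewrite sumr_const_nat subn0 mulr_natl.
have p3 : p%:R <= 2 * V ^+ 2 by nra.
have p0 : 0 <= p%:R :> R by [].
have V2 : 100 * V <= V ^+ 2 by rewrite expr2 ler_pM2r.
have V3 : 100 * V ^+ 2 <= V ^+ 3 by rewrite [leRHS]exprS ler_pM2r// exprn_gt0.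
have V4 : 100 * V ^+ 3 <= V ^+ 4 by rewrite [leRHS]exprS ler_pM2r// exprn_gt0.
have V5 : 100 * V ^+ 4 <= V ^+ 5 by rewrite [leRHS]exprS ler_pM2r// exprn_gt0.
split.
- rewrite (split_sum (fun j => a j.+1)).
  have n0' : 0 < n%:R :> R by rewrite ltr0n.
  have es := edge_sum n0 xmono xcount (p := p) _ xp; rewrite pn /= in es; have {}es := es isT.
  (* The comparison of [H] with [F] degenerates at -2, so it starts at [-2 + q] with [q = n^(-2/3)],
     the edge scale. Up to there [H] is at most [sqrt q = t^-2]; from there to [x p] it grows by at
     most [F (x p) / q], and [F (x p) <= (p + V) / n]. *)
  have Hx : 0 <= t ^+ 3 * H (x p) <= t * (1 + (p%:R + V)).
    apply/andP; split; first by rewrite mulr_ge0 ?(ltW t30)// sc_edge_ge0// ltW.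
    pose q := (t ^+ 4)^-1.
    have q0 : 0 < q by rewrite invr_gt0 exprn_gt0.
    have q1 : q <= 1 by rewrite invf_le1 ?exprn_gt0// exprn_ege1.
    have tq : t ^+ 4 * q = 1 by rewrite divff// gt_eqF// exprn_gt0.
    have bp : -2 + q <= x p.
      suff : q <= x p + 2 by lra.
      by rewrite -[q]mul1r ler_pdivrMr ?exprn_gt0//; move: Yp; rewrite /Y; lra.
    have b2 : -2 < -2 + q by lra.
    have hu := sc_edgeB_le b2 bp.
    have hb : H (-2 + q) <= (t ^+ 2)^-1.
      rewrite /sc_edge min_l; last by lra.
      apply: le_trans (sc_stieltjes_le_sqrt _) _; first by apply/andP; split; lra.
      rewrite addrAC addNr add0r /q (_ : (t ^+ 4)^-1 = ((t ^+ 2)^-1) ^+ 2);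
        last by rewrite exprVn -exprM.
      by rewrite sqrtr_sqr ger0_norm// invr_ge0 exprn_ge0// ltW.
    have F0 : 0 <= F (-2 + q).
      by rewrite -(@sc_cdf_eq0 R (-2))//; apply: sc_cdf_nondecreasing; lra.
    have p1n : (1 <= p <= n)%N by rewrite pn.
    have cl := count_le n0 xmono xcount p1n.
    have {}cl : t ^+ 6 * F (x p) <= p%:R + V.
      by rewrite tn (le_trans cl)// lerD2r ler_nat leq_pred.
    have {}hu : H (x p) <= (t ^+ 2)^-1 + F (x p) * t ^+ 4.
      have e : -2 + q + 2 = q by lra.
      move: hu; rewrite e /q invrK mulrBl.
      by have := mulr_ge0 F0 (exprn_ge0 4 (ltW t0)); lra.
    apply: le_trans (ler_wpM2l (ltW t30) hu) _.
    rewrite mulrDr [X in X + _](_ : _ = t); last by field; rewrite gt_eqF.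
    by have := ler_wpM2l (ltW t0) cl; lra.
  have e1 : t ^+ 3 * (\sum_(p <= j < n) (x j.+1 + 2)^-1 / n%:R) = \sum_(p <= j < n) t / Y j.+1.
    rewrite mulr_sumr; rewrite !big_nat; apply: eq_bigr => j /andP[pj jn].
    have tj : V ^+ 2 + V <= j.+1%:R by apply: tail; rewrite pj.
    have [xj _ _] := large jn tj.
    by rewrite /Y -tn; field; rewrite !gt_eqF//; lra.
  have e2 : `|\sum_(p <= j < n) a j.+1 - \sum_(p <= j < n) t / Y j.+1| <= 8 * t * V * V.
    rewrite -sumrB; apply: le_trans (ler_norm_sum _ _ _) _.
    apply: (@le_trans _ _ (\sum_(p <= j < n) 8 * t * V * (j.+1%:R)^-1)).
      rewrite !big_nat; apply: ler_sum => j /andP[pj jn].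
      have tj : V ^+ 2 + V <= j.+1%:R by apply: tail; rewrite pj.
      by have [] := tail_bounds jn tj.
    by rewrite -mulr_sumr ler_wpM2l// !mulr_ge0// ltW.
  (* The error of [edge_sum], multiplied by [t^3], is [5 t V / Y p], and [Y p >= V]. *)
  have e3 : `|\sum_(p <= j < n) t / Y j.+1 - t ^+ 3 * (1 - H (x p))| <= 5 * t.
    rewrite -e1 -mulrBr normrM (ger0_norm (ltW t30)).
    apply: le_trans (ler_wpM2l (ltW t30) es) _.
    have y0 : 0 < x p + 2 by lra.
    have -> : t ^+ 3 * (5 * ((x p + 2)^-1 * (V / n%:R))) = 5 * t * (V / Y p).
      by rewrite /Y -tn; field; rewrite !gt_eqF.
    rewrite ler_piMr ?mulr_ge0 ?(ltW t0)// ler_pdivrMr; lra.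
  have e4 : `|\sum_(0 <= j < p | Q j) a j.+1| <= p%:R * (V * t).
    exact: le_trans (ler_norm_sum _ _ _) head_abs.
  move: e2 e3 e4 Hx; rewrite !ler_norml => /andP[? ?] /andP[? ?] /andP[? ?] /andP[? ?].
  have pV : p%:R * V <= 2 * V ^+ 2 * V by rewrite ler_pM2r.
  (* In units of [t]: [p V] from the head, [8 V^2] from replacing [a j] by [t / Y j], 5 from [e3]
     and [1 + p + V] from [Hx]. *)
  have K : p%:R * V + 8 * V ^+ 2 + 6 + p%:R + V <= V ^+ 4 by lra.
  by have := ler_wpM2l (ltW t0) K; lra.
- rewrite (split_sum (fun j => a j.+1 ^+ 2)).
  have s1 : \sum_(p <= j < n) a j.+1 ^+ 2 <= 16 * t ^+ 2 * V.
    apply: (@le_trans _ _ (\sum_(p <= j < n) 16 * t ^+ 2 * (j.+1%:R)^-1)).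
      rewrite !big_nat; apply: ler_sum => j /andP[pj jn].
      have tj : V ^+ 2 + V <= j.+1%:R by apply: tail; rewrite pj.
      by have [] := tail_bounds jn tj.
    by rewrite -mulr_sumr ler_wpM2l// !mulr_ge0// ltW.
  have pV : p%:R * V ^+ 2 <= 2 * V ^+ 2 * V ^+ 2 by rewrite ler_pM2r// exprn_gt0.
  have K : p%:R * V ^+ 2 + 16 * V <= V ^+ 5 by lra.
  by have := ler_wpM2l (exprn_ge0 2 (ltW t0)) K; move: head_sq s1; lra.
Qed.
End EdgeEstimates.

(** * Logarithmic scales *)

Section LogScale.
Context {R : realType}.

(** The induction step is [ln (1 - u) <= - u] with [u] the inverse of the new index. *)
Lemma harmonic_sum_le (n : nat) : (0 < n)%N ->
  \sum_(0 <= j < n) (j.+1%:R : R)^-1 <= 1 + ln n%:R.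
Proof.
case: n => // n _; elim: n => [|n IH].
  by rewrite big_nat1 ln1 addr0 invr1.
rewrite big_nat_recr//=; apply: le_trans (lerD IH (lexx _)) _.
rewrite -addrA lerD2l.
have n1 : (n.+1%:R : R) = n.+2%:R * (1 - n.+2%:R^-1).
  by rewrite mulrBr mulr1 divff// -[n.+2%:R]natr1 addrK.
have n2 : 0 < 1 - (n.+2%:R : R)^-1.
  by rewrite subr_gt0 invf_lt1 ?ltr0n// ltr1n.
rewrite [in leLHS]n1 lnM ?posrE ?ltr0n//.
move: (_^-1) (ln n.+2%:R) n2 => u v u1.
by have : ln (1 - u) <= - u by [apply: le_ln1Dx; lra]; lra.
Qed.

Lemma natpow_root6 (n : nat) : natpow n (1/6 : R) ^+ 6 = n%:R.
Proof.
rewrite /natpow -powR_mulrn ?powR_ge0// -powRrM.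
by rewrite (_ : 1 / 6 * 6%:R = 1 :> R) ?powRr1//; field.
Qed.

Lemma natpow_root6_ge1 (n : nat) : (0 < n)%N -> 1 <= natpow n (1/6 : R).
Proof.
move=> n0; rewrite -(powRr0 n%:R); apply: ler_powR; first by rewrite ler1n.
by rewrite divr_ge0.
Qed.

Lemma natpow_root6_cube (n : nat) : natpow n (1/6 : R) ^+ 3 = Num.sqrt n%:R.
Proof.
have E : n%:R = (natpow n (1/6 : R) ^+ 3) ^+ 2 by rewrite -exprM natpow_root6.
rewrite [in RHS]E sqrtr_sqr ger0_norm//.
by rewrite exprn_ge0// powR_ge0.
Qed.

(** Applying [ln y < y] to [y = N^(1/(2q))] and raising to the power [q] bounds the left side by
    [c * sqrt N], which is at most [N] once [N >= c^2]. *)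
Lemma powR_ln_le (q : R) : 0 < q -> exists N0 : nat, forall N : nat, (N0 <= N)%N ->
  (ln (N%:R : R)) `^ q <= N%:R.
Proof.
move=> q0; pose c := (2 * q) `^ q.
exists (Num.truncn (c ^+ 2)).+1 => N NN.
have c0 : 0 < c by rewrite powR_gt0// mulr_gt0.
have cN : c ^+ 2 <= N%:R.
  apply: le_trans (ltW (truncnS_gt _)) _; by rewrite ler_nat.
have N0 : 0 < N%:R :> R by apply: lt_le_trans cN; rewrite exprn_gt0.
have N1 : 1 <= N%:R :> R by rewrite ler1n -(ltr0n R).
have q20 : 0 < (2 * q)^-1 by rewrite invr_gt0 mulr_gt0.
have l1 : ln N%:R <= 2 * q * N%:R `^ ((2 * q)^-1).
  have := ln_sublinear (powR_gt0 (2 * q)^-1 N0).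
  rewrite ln_powR mulrC ltr_pdivrMr ?mulr_gt0// => /ltW; by rewrite mulrC.
apply: le_trans (ge0_ler_powR (ltW q0) _ _ l1) _; rewrite ?nnegrE.
- exact: ln_ge0.
- by rewrite mulr_ge0 ?powR_ge0// mulr_ge0// ltW.
rewrite powRM ?powR_ge0//; last by rewrite mulr_ge0// ltW.
rewrite -powRrM -/c (_ : (2 * q)^-1 * q = 2^-1); last by field; rewrite gt_eqF.
rewrite powR12_sqrt ?(ltW N0)//.
have sN : Num.sqrt N%:R ^+ 2 = N%:R :> R by rewrite sqr_sqrtr// ltW.
rewrite -[leRHS]sN expr2 ler_wpM2r ?sqrtr_ge0//.
by rewrite -(ger0_norm (ltW c0)) -sqrtr_sqr ler_wsqrtr.
Qed.

(** A single power of [log N] dominates every polylogarithmic factor and every fixed constant, also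
    in dimension [N + s]. Since [N + s <= N^2], [ln (N + s)] is at most [2 ln N], hence at most
    [(ln N)^2]: this accounts for [2 C] in the exponent, and the extra 2 absorbs numerical
    factors. *)
Lemma log_scale (C B : R) (K : nat) : 0 < C -> 100 <= B -> K%:R <= B ->
  exists N0 : nat, forall N s : nat, (N0 <= N)%N -> (s <= K)%N ->
  [/\ 1 <= ln N%:R :> R,
      B <= logpow N (2 * C + 2),
      logpow N (2 * C + 2) ^+ 3 <= N%:R,
      1 + ln (N + s)%:R <= logpow N (2 * C + 2) /\
      logpow (N + s) C <= logpow N (2 * C + 2)
    & 4 * logpow N C <= logpow N (2 * C + 2) /\
      natpow (N + s) (1/6 : R) <= 2 * natpow N (1/6 : R)].
Proof.
move=> C0 B100 KB.
have q0 : 0 < (2 * C + 2) * 3 by lra.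
have [N1 HN1] := powR_ln_le q0.
exists (maxn N1 (Num.truncn (expR B)).+1) => N s; rewrite geq_max => /andP[NN1 NN2] sK.
have NB : expR B <= N%:R.
  by apply: le_trans (ltW (truncnS_gt _)) _; rewrite ler_nat.
have N0 : 0 < N%:R :> R by apply: lt_le_trans NB; rewrite expR_gt0.
set L := ln (N%:R : R); set V := logpow N _.
have LB : B <= L by rewrite -(expRK B) ler_ln ?posrE ?expR_gt0.
have LN : L < N%:R by exact: ln_sublinear.
have L1 : 1 <= L by lra.
have VE : V = L `^ (2 * C + 2) by [].
have LV2 : L ^+ 2 <= V.
  by rewrite VE -powR_mulrn ?ler_powR//; lra.
have L2 : 2 * L <= L ^+ 2 by nra.
have LV : L <= V by lra.
have sB : s%:R <= B :> R by apply: le_trans KB; rewrite ler_nat.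
have n2 : (N + s)%:R <= N%:R ^+ 2 :> R by rewrite natrD; nra.
have n0 : 0 < (N + s)%:R :> R by rewrite natrD; apply: ltr_wpDr.
have ln2 : ln (N + s)%:R <= 2 * L.
  rewrite mulr_natl -lnXn// ler_ln ?posrE ?exprn_gt0//.
have lnL : L <= ln (N + s)%:R by rewrite ler_ln ?posrE// ler_nat leq_addr.
split=> //.
- lra.
- rewrite -powR_mulrn ?powR_ge0// /V /logpow -powRrM; exact: HN1.
- split; first by rewrite (le_trans _ LV2)// (le_trans (lerD (lexx 1) ln2))//; nra.
  apply: (@le_trans _ _ ((L ^+ 2) `^ C)).
    apply: ge0_ler_powR; rewrite ?nnegrE ?sqr_ge0 ?(ltW C0)//.
      by apply: le_trans lnL; lra.
    exact: le_trans ln2 L2.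
  rewrite -powR_mulrn; last lra.
  by rewrite -powRrM VE ler_powR//; lra.
- split.
    have -> : V = logpow N C * L `^ (C + 2).
      rewrite /logpow -powRD; last by apply/implyP => _; rewrite (gt_eqF (lt_le_trans ltr01 L1)).
      by rewrite VE; congr (_ `^ _); ring.
    rewrite mulrC ler_wpM2l ?powR_ge0//.
    apply: (@le_trans _ _ (L `^ 2)); last by rewrite ler_powR//; lra.
    by rewrite powR_mulrn; nra.
  rewrite -(@ler_pXn2r _ 6) ?nnegrE ?powR_ge0// ?mulr_ge0 ?powR_ge0//.
  by rewrite exprMn !natpow_root6 natrD; lra.
Qed.
End LogScale.

(** * Chebyshev's inequality, change of dimension, thresholds and conclusion *)

Lemma chebyshev_sqr (R : realType) (d : measure_display) (T : measurableType d)
    (P : probability T R) (W : T -> R) (c : R) : 0 < c -> measurable_fun setT W ->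
  P.-integrable setT (EFin \o (fun w => W w ^+ 2)) ->
  (P [set w | (c <= `|W w|)%R] <= ((\int[P]_w (W w ^+ 2)) / c ^+ 2)%:E)%E.
Proof.
move=> c0 mW iW.
have mono : {in Num.nneg &, {homo (fun x : R => x ^+ 2) : x y / x <= y}}.
  by move=> x y x0 y0 xy; rewrite ler_pXn2r.
have := @markov _ _ _ P (mfun_Sub (mem_set mW)) (fun x => x ^+ 2) c c0
  (measurable_funX 2 (@measurable_id _ _ setT)) (fun r _ => sqr_ge0 r) mono.
rewrite unlock.
have -> : (\int[P]_w ((((fun x => x ^+ 2) \o (fun x : R => `|x|)) \o
    mfun_Sub (mem_set mW)) w)%:E = (\int[P]_w (W w ^+ 2)%R)%:E)%E.
  rewrite /Rintegral fineK; last exact: integrable_fin_num iW.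
  by apply: eq_integral => w _ /=; rewrite real_normK// num_real.
by move=> h; rewrite EFinM lee_pdivlMr ?exprn_gt0// muleC.
Qed.

(** The counting condition of [in_class] speaks of a classical set, the counting lemmas of a finite
    set. *)
Lemma card_set_classical (n : nat) (p : pred 'I_n) :
  #|[set j : 'I_n | p j]%classic| = #|[set j : 'I_n | p j]%SET|.
Proof. by apply: eq_card => j; apply/idP/idP; rewrite !inE. Qed.

(** With [u = N^(1/6)] and [t = (N + s)^(1/6)], the square roots of [N] and [N + s] are [u^3] and
    [t^3], and they differ by [s / (t^3 + u^3) <= K / (2 u)]. Recentring [z] from one edge to the
    other therefore costs no more than its allowed distance. *)
Lemma edge_shift (R : realType) (t u V q z K s : R) :
  1 <= u -> u <= t -> t <= 2 * u -> t ^+ 6 = u ^+ 6 + s -> s <= K ->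
  0 <= K -> 4 * K <= V -> 0 <= q -> 4 * q <= V -> `|z + 2 * u ^+ 3| <= q / u ->
  [/\ 0 <= t ^+ 3 - u ^+ 3, t ^+ 3 - u ^+ 3 <= V,
      `|z + 2 * t ^+ 3| <= V / t & `|z + 2 * u ^+ 3| <= V * u].
Proof.
move=> u1 ut t2 tu sK K0 KV q0 qV zb.
have V0 : 0 <= V by lra.
have u0 : 0 < u by exact: lt_le_trans u1.
have t0 : 0 < t by exact: lt_le_trans ut.
have d0 : 0 <= t ^+ 3 - u ^+ 3 by rewrite subr_ge0 ler_pXn2r// nnegrE ltW.
have d1 : (t ^+ 3 - u ^+ 3) * (2 * u) <= K.
  have e : (t ^+ 3 - u ^+ 3) * (t ^+ 3 + u ^+ 3) = s.
    by rewrite (_ : _ * _ = t ^+ 6 - u ^+ 6); [rewrite tu addrAC subrr add0r|ring].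
  apply: le_trans sK; rewrite -e ler_wpM2l//.
  have u31 : u <= u ^+ 3 by rewrite exprS ler_peMr ?(ltW u0)// exprn_ege1.
  by clear -d0 u31; lra.
split=> //.
- have h : (t ^+ 3 - u ^+ 3) * 1 <= (t ^+ 3 - u ^+ 3) * (2 * u).
    by rewrite ler_wpM2l//; clear -u1; lra.
  by clear -h d1 KV K0; lra.
- have -> : z + 2 * t ^+ 3 = (z + 2 * u ^+ 3) + 2 * (t ^+ 3 - u ^+ 3) by ring.
  apply: le_trans (ler_normD _ _) _.
  rewrite [X in _ + X]ger0_norm; last by rewrite mulr_ge0.
  have h1 : (V / 2) / u <= V / t.
    rewrite ler_pdivrMr// mulrAC ler_pdivlMr//.
    by have := ler_wpM2l V0 t2; clear; lra.
  apply: le_trans h1; apply: le_trans (lerD zb (lexx _)) _.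
  rewrite ler_pdivlMr// mulrDl mulfVK ?gt_eqF//.
  by clear -d1 qV KV; lra.
- apply: le_trans zb _; apply: (@le_trans _ _ q); first by rewrite ler_pdivrMr// ler_peMr.
  by apply: (@le_trans _ _ V); [clear -q0 qV; lra|rewrite ler_peMr].
Qed.

(** Above [i] the gap [lam i.+1 - lam i] separates [z] from [lam j]; below [i.-1] the gap between
    [lam i.-1] and its predecessor does. For [i = 1] no index lies below. *)
Lemma separated_from_spectrum (R : realType) (lam : nat -> R) (n l i : nat) (g z : R) :
  (forall j k, (1 <= j <= k)%N -> (k <= n)%N -> lam j <= lam k) ->
  (forall j, (1 <= j <= l)%N -> g <= lam j.+1 - lam j) ->
  (1 <= i <= l)%N -> (i <= n)%N -> (i = 1%N \/ lam i.-1 < z) -> z < lam i ->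
  forall j, (1 <= j <= n)%N -> j != i.-1 -> j != i -> g <= `|lam j - z|.
Proof.
move=> lmono cgap /andP[i1 il] iN zl zu j /andP[j1 jn] ji1 ji.
have [ij|ij] := ltnP i j.
  have h : g <= lam i.+1 - lam i by apply: cgap; rewrite i1.
  have h2 : lam i.+1 <= lam j by apply: lmono; rewrite //= ij.
  by apply: le_trans (ler_norm _); clear -h h2 zu; lra.
have {}ij : (j < i)%N by rewrite ltn_neqAle ji.
case: i i1 il zl zu iN ji1 ji ij => [//|[|i]] /= i1 il zl zu iN ji1 ji ij.
  by move: j1 ij; case: (j).
have ji' : (j <= i)%N by rewrite -ltnS ltn_neqAle ji1.
case: zl => // zl.
have h2 : lam j <= lam i.
  by apply: lmono; rewrite ?j1//; apply: leq_trans iN; rewrite ltnW.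
rewrite distrC; apply: le_trans (ler_norm _).
have h : g <= lam i.+1 - lam i.
  by apply: cgap; rewrite (leq_trans j1 ji') /= ltnW// ltnW.
by clear -h h2 zl; lra.
Qed.

Section Threshold.
Context {R : realType} (V a t u : R).
Hypotheses (V100 : 100 <= V) (a1 : 1 <= a) (u1 : 1 <= u) (t0 : 0 <= t) (t2 : t <= 2 * u).

Let V0 : 0 < V. Proof. exact: lt_le_trans V100. Qed.
Let u0 : 0 < u. Proof. exact: lt_le_trans u1. Qed.
Let Vp k : 100 * V ^+ k <= V ^+ k.+1.
Proof. by rewrite [leRHS]exprS ler_pM2r// exprn_gt0. Qed.

Lemma mean_le_threshold (x y : R) : `|x| <= V * u -> `|y| <= V ^+ 4 * t + V ->
  `|x + y| <= V ^+ 7 * a * u / 2.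
Proof.
move=> b1 b2; apply: le_trans (ler_normD _ _) _; apply: le_trans (lerD b1 b2) _.
have b3 : V ^+ 4 * t <= V ^+ 4 * (2 * u) by rewrite ler_pM2l// exprn_gt0.
have b4 : V <= V * u by rewrite ler_peMr// ltW.
have Vau : V ^+ 7 * u <= V ^+ 7 * a * u.
  by rewrite ler_pM2r// ler_peMr// exprn_ge0// ltW.
have Kb : V ^+ 4 * 2 + 2 * V <= V ^+ 7 / 2.
  have := Vp 1; have := Vp 2; have := Vp 3; have := Vp 4; have := Vp 5.
  have := Vp 6; move: V0; rewrite expr1; lra.
by have := ler_wpM2r (ltW u0) Kb; lra.
Qed.

(** [a] plays the role of [(log N)^A]. It enters the threshold once, hence its square twice, so one
    factor remains after division by [a], and [V^14] against [V^6] absorbs the constants. *)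
Lemma second_moment_le_threshold (M S : R) : M <= V -> 0 <= S -> S <= V ^+ 5 * t ^+ 2 ->
  2 + 2 * (4 * M * S) <= a^-1 * (V ^+ 7 * a * u / 2) ^+ 2.
Proof.
move=> MV S0 SV.
have b1 : 4 * M * S <= 4 * V * (V ^+ 5 * t ^+ 2).
  apply: (@le_trans _ _ (4 * V * S)); first by apply: ler_wpM2r => //; lra.
  by apply: ler_wpM2l => //; move: V0; lra.
have b2 : t ^+ 2 <= (2 * u) ^+ 2 by rewrite ler_pXn2r// nnegrE// mulr_ge0// ltW.
have b3 : V ^+ 6 * t ^+ 2 <= V ^+ 6 * (2 * u) ^+ 2 by rewrite ler_pM2l// exprn_gt0.
have b4 : 1 <= u ^+ 2 by rewrite exprn_ege1.
have V7 : 4 <= V ^+ 7 /\ 2 + 32 * V ^+ 6 <= V ^+ 7.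
  have := Vp 1; have := Vp 2; have := Vp 3; have := Vp 4; have := Vp 5.
  have := Vp 6; move: V100; rewrite expr1; lra.
have c1 : 2 + 2 * (4 * M * S) <= V ^+ 7 * u ^+ 2.
  by have := ler_wpM2r (exprn_ge0 2 (ltW u0)) V7.2; lra.
apply: le_trans c1 _.
have -> : a^-1 * (V ^+ 7 * a * u / 2) ^+ 2 = V ^+ 7 * u ^+ 2 * (V ^+ 7 * a / 4).
  by field; rewrite gt_eqF//; apply: lt_le_trans a1.
rewrite ler_peMr ?mulr_ge0 ?exprn_ge0 ?(ltW V0) ?(ltW u0)//.
have : V ^+ 7 * 1 <= V ^+ 7 * a by rewrite ler_pM2l// exprn_gt0.
by move: V7.1; lra.
Qed.
End Threshold.

(** The shift [m] uses up at most half of the level [L]. Chebyshev's inequality then applies to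
    [D - W], whose second moment is bounded through [(x - y)^2 <= 2 x^2 + 2 y^2]. *)
Lemma prob_shifted_sum_le (R : realType) (d : measure_display) (T : measurableType d)
    (P : probability T R) (D W : T -> R) (m L v : R) :
  measurable_fun setT D -> measurable_fun setT W ->
  Ex P (fun w => D w ^+ 2) = 1%E ->
  P.-integrable setT (EFin \o (fun w => W w ^+ 2)) ->
  \int[P]_w (W w ^+ 2) <= v -> 0 < L -> `|m| <= L / 2 ->
  (P [set w | (L <= `|(D w - W w) - m|)%R] <= ((2 + 2 * v) / (L / 2) ^+ 2)%:E)%E.
Proof.
move=> mD mW D2 iW vW L0 hm.
have L2 : 0 < L / 2 by rewrite divr_gt0.
have mDW : measurable_fun setT (fun w => D w - W w) by exact: measurable_funB.
have iD : P.-integrable setT (EFin \o (fun w => D w ^+ 2)).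
  apply/integrableP; split; first by apply/measurable_EFinP; exact: measurable_funX.
  have e : (\int[P]_w `|((D w ^+ 2)%R)%:E| = 1)%E.
    by rewrite -D2; apply: eq_integral => w _ /=; rewrite ger0_norm ?sqr_ge0.
  by apply: (@eq_ind _ _ (fun x => (x < +oo)%E) (ltry 1) _ (esym e)).
have iD2 : P.-integrable setT (EFin \o (fun w => 2 * D w ^+ 2)).
  by apply: eq_integrable (integrableZl measurableT 2 iD).
have iW2 : P.-integrable setT (EFin \o (fun w => 2 * W w ^+ 2)).
  by apply: eq_integrable (integrableZl measurableT 2 iW).
have iDW2 : P.-integrable setT (EFin \o (fun w => 2 * D w ^+ 2 + 2 * W w ^+ 2)).
  by apply: eq_integrable (integrableD measurableT iD2 iW2).
have sqB x y : (x - y) ^+ 2 <= 2 * x ^+ 2 + 2 * y ^+ 2 :> R.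
  by have := sqr_ge0 (x + y); clear; lra.
have iDW : P.-integrable setT (EFin \o (fun w => (D w - W w) ^+ 2)).
  apply: le_integrable iDW2 => //; first by apply/measurable_EFinP; exact: measurable_funX.
  move=> w _ /=; rewrite lee_fin !ger0_norm ?sqr_ge0//.
  by rewrite addr_ge0// mulr_ge0// sqr_ge0.
have mset c (f : T -> R) : measurable_fun setT f -> measurable [set w | c <= `|f w|].
  move=> mf; have mnf : measurable_fun setT (fun w => `|f w|) by exact: measurableT_comp.
  have -> : [set w | c <= `|f w|] = (fun w => `|f w|) @^-1` `[c, +oo[.
    by apply/seteqP; split=> w /=; rewrite in_itv /= andbT.
  by rewrite -[X in measurable X]setTI; exact: mnf.
apply: (@le_trans _ _ (P [set w | (L / 2 <= `|D w - W w|)%R])).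
  apply: le_measure; rewrite ?inE; [by apply: mset; exact: measurable_funB|exact: mset|].
  move=> w /= h; have := ler_normB (D w - W w) m; clear -h hm; lra.
apply: le_trans (chebyshev_sqr L2 mDW iDW) _; rewrite lee_fin.
apply: ler_wpM2r; first by rewrite invr_ge0 sqr_ge0.
apply: (@le_trans _ _ (\int[P]_w (2 * D w ^+ 2 + 2 * W w ^+ 2))).
  by apply: le_Rintegral.
rewrite (RintegralD measurableT iD2 iW2) (RintegralZl 2 measurableT iD).
rewrite (RintegralZl 2 measurableT iW).
have -> : \int[P]_w (D w ^+ 2) = 1 by rewrite /Rintegral; move: D2; rewrite /Ex => ->.
by rewrite mulr1 lerD2l ler_pM2l.
Qed.

Unset Implicit Arguments.
Set Strict Implicit.

Theorem mainTheorem4 (R : realType) (beta K l : nat) (C M4 : R) :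
  (beta = 1 \/ beta = 2)%N -> (1 <= K)%N -> (1 <= l)%N -> 0 < C ->
  forall A : R, 0 < A ->
  exists C' : R, 0 < C' /\
  exists N0 : nat, forall N : nat, (N0 <= N)%N ->
  forall s : nat, (s <= K - 1)%N ->
  forall i : nat, (1 <= i <= l)%N ->
  forall (M U : 'M[R[i]]_(N + s)) (lam : nat -> R),
    spectral_data beta M U lam ->
    in_class l C U lam ->
  forall (d : measure_display) (T : measurableType d) (P : probability T R)
         (X Y : 'I_(N + s) -> T -> R) (D : T -> R),
    wigner_column P beta M4 X Y D ->
  forall z : R,
    (i = 1%N \/ lam i.-1 < z) -> z < lam i ->
    `| z + 2 * Num.sqrt (N%:R) | <= logpow N C * natpow N (- (1/6)) ->
    (P [set w | (logpow N C' * natpow N (1/6)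
                  <= `| calE N i U lam (fun k => X k w) (fun k => Y k w) (D w) z |)%R]
     <= (logpow N (- A))%:E)%E.
Proof.
move=> _ _ _ C0 A A0.
pose c0 := 2 * C + 2.
(* [B] collects the constants that [V] must exceed: 100 for the numerical inequalities, [4 * K] for
   [edge_shift], [l] for the index [i], and the fourth-moment bound. *)
pose B := 100 + 4 * K%:R + l%:R + `|M4|.
have [K0 l0 M0] : [/\ 0 <= K%:R :> R, 0 <= l%:R :> R & 0 <= `|M4|] by [].
have B1 : 100 <= B by rewrite /B; lra.
have B2 : K%:R <= B by rewrite /B; lra.
have [N1 HN] := log_scale C0 B1 B2.
(* With [V = (log N)^c0], the mean is at most [V^5 N^(1/6)] and the second moment at
   most [V^7 N^(1/3)], so the threshold [V^7 (log N)^A N^(1/6)] suffices. *)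
exists (c0 * 7 + A); split; first by rewrite /c0; lra.
exists N1 => N NN s sK i /andP[i1 il] M U lam [_ _ UU _ lmono] [cls1 _ cls3].
move=> d T P X Y D wc z zl zu zb.
have sK' : (s <= K)%N by apply: leq_trans sK _; rewrite leq_subr.
have [L1 VB V3 [lnV CV] [C4 t2]] := HN N s NN sK'.
have N0 : (0 < N)%N by case: (posnP N) L1 => // ->; rewrite ln0//; lra.
have n0 : (0 < N + s)%N by rewrite addn_gt0 N0.
have t6 := natpow_root6 (R := R) (N + s); have u6 := natpow_root6 (R := R) N.
have t1 := natpow_root6_ge1 (R := R) n0; have u1 := natpow_root6_ge1 (R := R) N0.
have t3 := natpow_root6_cube (R := R) (N + s); have u3 := natpow_root6_cube (R := R) N.
have iNV : natpow N (- (1/6)) = (natpow N (1/6 : R))^-1 by rewrite /natpow powRN.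
have inV : natpow (N + s) (- (1/6)) = (natpow (N + s) (1/6 : R))^-1 by rewrite /natpow powRN.
rewrite iNV -u3 in zb.
have aE : logpow N (c0 * 7 + A) = logpow N c0 ^+ 7 * logpow N A.
  rewrite /logpow powRD; last by apply/implyP => _; rewrite (gt_eqF (lt_le_trans ltr01 L1)).
  by rewrite powRrM powR_mulrn// powR_ge0.
have a1 : 1 <= logpow N A by rewrite -(powRr0 (ln N%:R)) ler_powR// ltW.
have aN : logpow N (- A) = (logpow N A)^-1 by rewrite /logpow powRN.
have LC0 : 0 <= logpow N C by rewrite powR_ge0.
rewrite {}aE {}aN.
(* The powers of the logarithm become variables [a], [V] and [q], related only by the inequalities
   just recorded. *)
move: (logpow N A) a1 => a a1.
rewrite -/c0 in VB V3 lnV CV C4.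
move: (logpow N c0) VB V3 lnV CV C4 => V VB V3 lnV CV C4.
move: (logpow N C) LC0 zb C4 => q LC0 zb C4.
have V100 : 100 <= V by exact: le_trans VB.
have V0 : 0 < V by exact: lt_le_trans V100.
have KV : 4 * K%:R <= V by apply: le_trans VB; rewrite /B; clear -K0 l0 M0; lra.
have lV : l%:R <= V by apply: le_trans VB; rewrite /B; clear -K0 l0 M0; lra.
have MV : M4 <= V.
  by apply: le_trans (ler_norm _) (le_trans _ VB); rewrite /B; clear -K0 l0 M0; lra.
have iV : i%:R <= V by apply: le_trans lV; rewrite ler_nat.
have sK2 : s%:R <= K%:R :> R by rewrite ler_nat.
set t := natpow (N + s) (1/6 : R) in t1 t2 t3 t6 inV *.
set u := natpow N (1/6 : R) in u1 u3 u6 t2 zb *.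
have t0 : 0 < t by exact: lt_le_trans t1.
have u0 : 0 < u by exact: lt_le_trans u1.
have ut : u <= t.
  rewrite -(@ler_pXn2r _ 6) ?nnegrE ?(ltW t0) ?(ltW u0)//.
  by rewrite t6 u6 ler_nat leq_addr.
have tu : t ^+ 6 = u ^+ 6 + s%:R by rewrite t6 u6 natrD.
have [d0 d1 zt zu3] := edge_shift u1 ut t2 tu sK2 K0 KV LC0 C4 zb.
have harm : \sum_(0 <= j < N + s) (j.+1%:R : R)^-1 <= V.
  exact: le_trans (harmonic_sum_le n0) lnV.
have Vn : V ^+ 3 <= (N + s)%:R by apply: le_trans V3 _; rewrite ler_nat leq_addr.
have count E : `|#|[set j : 'I_(N + s) | lam j.+1 <= E * t ^+ 3]%SET|%:R
    - (N + s)%:R * sc_cdf E| <= V.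
  by rewrite t3 -card_set_classical; exact: le_trans (cls1 E) CV.
have iN : (i <= N + s)%N.
  rewrite -(ler_nat R) (le_trans iV)// (le_trans _ Vn)// exprS.
  by rewrite ler_peMr ?(ltW V0)// exprn_ege1// (le_trans _ V100)// ler1n.
have cgap j : (1 <= j <= l)%N -> (V * t)^-1 <= lam j.+1 - lam j.
  move=> jl; have [_ h] := cls3 j jl; apply: le_trans h.
  rewrite inV /logpow powRN -/(logpow _ _) -invfM lef_pV2 ?posrE.
  - by rewrite ler_pM2r.
  - by rewrite mulr_gt0.
  - rewrite mulr_gt0// powR_gt0//; apply: (lt_le_trans ltr01).
    by apply: le_trans L1 _; rewrite ler_ln ?posrE ?ltr0n// ler_nat leq_addr.
have il' : (1 <= i <= l)%N by rewrite i1.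
have gap := separated_from_spectrum lmono cgap il' iN zl zu.
have [es1 es2] := edge_estimates t1 t6 V100 Vn harm iV lmono count zt gap.
pose Q (j : 'I_(N + s)) := (j.+1 != i.-1) && (j.+1 != i).
(* Weight 0 at the two excluded indices turns the restricted sum into a form over all
   eigenvectors. *)
pose al (j : 'I_(N + s)) := if Q j then (lam j.+1 - z)^-1 else 0.
have [W [mW iW vW WE]] := wigner_quadratic_form al wc UU.
have s1 : \sum_j al j = \sum_(j < N + s | Q j) (lam j.+1 - z)^-1.
  by rewrite [RHS]big_mkcond.
have s2 : \sum_j al j ^+ 2 = \sum_(j < N + s | Q j) (lam j.+1 - z)^-1 ^+ 2.
  rewrite [RHS]big_mkcond; apply: eq_bigr => j _; rewrite /al.
  by case: ifP => // _; rewrite expr0n.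
pose m := (z + 2 * u ^+ 3) + (\sum_j al j - u ^+ 3).
have cE w : calE N i U lam (fun k => X k w) (fun k => Y k w) (D w) z = (D w - W w) - m.
  rewrite /calE -u3 -/Q.
  have -> : \sum_(j < N + s | Q j)
      cabs2 (\sum_k (U k j)^* * (X k w +i* Y k w)%C) / (lam j.+1 - z) =
      \sum_j al j + W w.
    rewrite -WE big_mkcond; apply: eq_bigr => j _; rewrite /al.
    by case: ifP => _; rewrite ?mul0r// mulrC.
  by rewrite /m; ring.
have hm : `|m| <= V ^+ 7 * a * u / 2.
  apply: (mean_le_threshold V100 a1 u1 t2 zu3).
  (* The estimate for the sum is centred at [sqrt (N + s)], while [calE] is centred at [sqrt N]. *)
  have -> : \sum_j al j - u ^+ 3 = (\sum_j al j - t ^+ 3) + (t ^+ 3 - u ^+ 3) by ring.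
  by rewrite (le_trans (ler_normD _ _))// s1 (ger0_norm d0) lerD.
have [[mX [mY mD]] _ [D1 D2 D4] _ _] := wc.
have L0 : 0 < V ^+ 7 * a * u by rewrite !mulr_gt0 ?exprn_gt0// (lt_le_trans ltr01).
under eq_set do rewrite cE.
apply: le_trans (prob_shifted_sum_le mD mW D2 iW vW L0 hm) _; rewrite lee_fin.
rewrite ler_pdivrMr ?exprn_gt0 ?divr_gt0//.
apply: (second_moment_le_threshold V100 a1 u1 (ltW t0) t2 MV).
  by apply: sumr_ge0 => j _; exact: sqr_ge0.
by rewrite s2.
Qed.
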